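(* Let a choice of parameters of the Diamond ensemble be given (a positive integer $n$, constants $A\ge 2$ and $c>0$, an infinite set $\mathcal{M}$ of positive integers, and for each $M\in\mathcal{M}$ admissible integers $t_\ell,\alpha_\ell,\beta_\ell$, as described in the context). Then there exist two constants $c_1,c_2\in\mathbb{R}_+$ (strictly positive), depending only on the choice of parameters (not on $M$, $N$ or the phases $\theta_j$), such that for every $M\in\mathcal{M}$ and every choice of phases $\theta_1,\dots,\theta_{2M-1}$, $$\frac{c_1}{\sqrt N}\le D_{\sup,\mathrm{cap}}(\diamond(N))\le \frac{c_2}{\sqrt N},$$ where $N$ is the number of points of $\diamond(N)$.
   Context: Diamond ensemble. A choice of parameters consists of a positive integer $n$, constants $A\ge 2$ and $c>0$, an infinite set $\mathcal{M}$ of positive integers, and for each $M\in\mathcal{M}$ integers $0=t_0<t_1<\dots<t_n=M$ and $\alpha_1,\dots,\alpha_n,\beta_1,\dots,\beta_n$ (which may depend on $M$) such that: $\alpha_1=0$; $\alpha_\ell,\beta_\ell\ge 0$; $\beta_1>0$; $\alpha_\ell\le AM$ and $\beta_\ell\le A$ for all $1\le\ell\le n$; $t_1\ge cM$; and the function $r:[0,2M]\to\mathbb{R}$ defined by $r(x)=\alpha_\ell+\beta_\ell x$ for $t_{\ell-1}\le x\le t_\ell$ and $r(x)=r(2M-x)$ is well defined and continuous. The constants $A$ and $c$ do not depend on $M$. Put $p=2M-1$, $r_j=r(j)$ for $1\le j\le p$, $N=2+\sum_{j=1}^{p}r_j$, and $$z_j=1-\frac{1+r_j+2\sum_{k=1}^{j-1}r_k}{N-1},\qquad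 1\le j\le p.$$ For arbitrary phases $\theta_j\in[0,2\pi]$, the set $\diamond(N)\subset\mathbb{S}^2$ consists of the North pole $(0,0,1)$, the South pole $(0,0,-1)$ and the points $$x_j^i=\left(\sqrt{1-z_j^2}\cos\left(\tfrac{2\pi i}{r_j}+\theta_j\right),\sqrt{1-z_j^2}\sin\left(\tfrac{2\pi i}{r_j}+\theta_j\right),z_j\right),\quad 1\le j\le p,\ 1\le i\le r_j.$$ Spherical cap discrepancy. Let $\mu$ be Lebesgue (surface) measure on the unit sphere $\mathbb{S}^2\subset\mathbb{R}^3$, so $\mu(\mathbb{S}^2)=4\pi$, and let $\mathrm{cap}$ be the set of all spherical caps $\{x\in\mathbb{S}^2:\langle x,u\rangle\ge t\}$, $u\in\mathbb{S}^2$, $t\in[-1,1]$. For an $N$-point set $\omega_N\subset\mathbb{S}^2$, $$D_{\sup,\mathrm{cap}}(\omega_N)=\sup_{C\in\mathrm{cap}}\left|\frac{\#(\omega_N\cap C)}{N}-\frac{\mu(C)}{4\pi}\right|.$$ *)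

(* Defs.v *)
From mathcomp Require Import all_boot all_order all_algebra.
From mathcomp Require Import finmap.
From mathcomp Require Import all_classical all_reals all_analysis.

Set Implicit Arguments.
Unset Strict Implicit.
Unset Printing Implicit Defensive.

Import Order.TTheory GRing.Theory Num.Theory.
Import numFieldNormedType.Exports.

Local Open Scope classical_set_scope.
Local Open Scope ring_scope.

Section Sphere.
Variable R : realType.
Implicit Types (x u : 'rV[R]_3) (A C omega : set 'rV[R]_3).

Definition point3 (a b c : R) : 'rV[R]_3 :=
  \row_(i < 3) nth 0 [:: a; b; c] i.

Definition dot x u : R := \sum_(i < 3) x 0 i * u 0 i.

(* The library norm on row vectors is the sup norm, so the Euclidean unit
   sphere has to be described through the inner product. *)
Definition sphere2 : set 'rV[R]_3 := [set x | dot x x = 1].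

Definition spherical_coordinates (phi theta : R) : 'rV[R]_3 :=
  point3 (sin phi * cos theta) (sin phi * sin theta) (cos phi).

(* Surface measure as the surface integral over the standard parametrization
   by colatitude phi and longitude theta, whose area element
   |d_phi x d_theta| is sin phi. *)
Definition surface_measure A : \bar R :=
  let D : set (R * R) := `[0, pi] `*` `[0, 2 * pi] in
  (\int[lebesgue_measure \x lebesgue_measure]_(w in D)
     (\1_A (spherical_coordinates w.1 w.2) * sin w.1)%:E)%E.

Definition spherical_cap u (t : R) : set 'rV[R]_3 :=
  [set x | sphere2 x /\ t <= dot x u].

Definition caps : set (set 'rV[R]_3) :=
  [set C | exists u t, [/\ sphere2 u, -1 <= t <= 1 & C = spherical_cap u t]].

(* The number of elements of a finite set, as a real number. *)
Definition card_set A : R := (#|` fset_set A|)%fset%:R.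

Definition cap_discrepancy omega : R :=
  sup [set `|card_set (omega `&` C) / card_set omega
             - fine (surface_measure C) / (4 * pi)| | C in caps].

End Sphere.

(* A choice of parameters of the Diamond ensemble.  The index l of t, alpha,
   beta runs over 1 <= l <= n (and t also has the index 0); other values are
   irrelevant.  The last three fields say that the prescription
   for r is well defined and continuous: they determine r M on [0, 2M], the
   only place where it is used. *)
Record diamond_parameters (R : realType) := DiamondParameters {
  dn : nat;
  dA : R;
  dc : R;
  dM : set nat;
  dt : nat -> nat -> nat;
  dalpha : nat -> nat -> nat;
  dbeta : nat -> nat -> nat;
  dr : nat -> R -> R;
  dn_gt0 : (0 < dn)%N;
  dA_ge2 : 2 <= dA;
  dc_gt0 : 0 < dc;
  dM_infinite : infinite_set dM;
  dM_gt0 : forall M, dM M -> (0 < M)%N;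
  dt_first : forall M, dM M -> dt M 0 = 0%N;
  dt_last : forall M, dM M -> dt M dn = M;
  dt_incr : forall M l, dM M -> (1 <= l <= dn)%N -> (dt M l.-1 < dt M l)%N;
  dalpha_first : forall M, dM M -> dalpha M 1 = 0%N;
  dbeta_first : forall M, dM M -> (0 < dbeta M 1)%N;
  dalpha_le : forall M l, dM M -> (1 <= l <= dn)%N ->
    (dalpha M l)%:R <= dA * M%:R;
  dbeta_le : forall M l, dM M -> (1 <= l <= dn)%N -> (dbeta M l)%:R <= dA;
  dt_ge : forall M, dM M -> dc * M%:R <= (dt M 1)%:R;
  dr_piece : forall M l (x : R), dM M -> (1 <= l <= dn)%N ->
    (dt M l.-1)%:R <= x <= (dt M l)%:R ->
    dr M x = (dalpha M l)%:R + (dbeta M l)%:R * x;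
  dr_sym : forall M (x : R), dM M -> 0 <= x <= 2 * M%:R ->
    dr M x = dr M (2 * M%:R - x);
  dr_continuous : forall M, dM M ->
    {within `[0, 2 * M%:R]%classic, continuous (dr M)}
}.

Section Diamond.
Variables (R : realType) (P : diamond_parameters R) (M : nat).

Definition diamond_p : nat := (2 * M - 1)%N.

Definition diamond_r (j : nat) : R := dr P M j%:R.

Definition diamond_N : R := 2 + \sum_(1 <= j < diamond_p.+1) diamond_r j.

Definition diamond_z (j : nat) : R :=
  1 - (1 + diamond_r j + 2 * \sum_(1 <= k < j) diamond_r k) / (diamond_N - 1).

Definition diamond_point (theta : nat -> R) (j i : nat) : 'rV[R]_3 :=
  let rho := Num.sqrt (1 - diamond_z j ^+ 2) in
  let phi := 2 * pi * i%:R / diamond_r j + theta j in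
  point3 (rho * cos phi) (rho * sin phi) (diamond_z j).

Definition diamond (theta : nat -> R) : set 'rV[R]_3 :=
  [set point3 0 0 1; point3 0 0 (-1)] `|`
  [set x | exists j i : nat,
     [/\ (1 <= j <= diamond_p)%N, (1 <= i)%N, i%:R <= diamond_r j
       & x = diamond_point theta j i]].

End Diamond.

(* Main.v *)
(** The parallels cut the sphere into zones of area [4 pi r_j / (N - 1)], the
    [j]-th parallel lying at the middle height of the [j]-th zone, with two
    polar caps of area [2 pi / (N - 1)] left over.  A cap meets each parallel
    in an arc, so its number of points on the [j]-th parallel differs from
    [r_j f_j] by a bounded amount, where [f_j] is the fraction of that parallel
    inside the cap.  As a function of the colatitude, this fraction is monotone
    on at most two pieces, hence of bounded variation, so [sum_j r_j f_j] is a
    quadrature of the area of the cap with error [O(max_j r_j)].  Altogether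
    the error is [O(M)] points, and [N] is of exact order [M^2].  For the lower
    bound, the closed northern hemisphere contains the equatorial parallel,
    which makes its count exceed [N / 2] by at least [r_M / 2 >= c M / 2]. *)

Require Import Defs.
From mathcomp Require Import all_boot all_order all_algebra.
From mathcomp Require Import finmap.
From mathcomp Require Import all_classical all_reals all_analysis.
From mathcomp Require Import measurable_realfun.
From mathcomp Require Import ring lra zify.

Set Implicit Arguments.
Unset Strict Implicit.
Unset Printing Implicit Defensive.

Import Order.TTheory GRing.Theory Num.Theory.
Import numFieldNormedType.Exports.

Local Open Scope classical_set_scope.
Local Open Scope ring_scope.

(** * Bounded variation and the error of one-point quadrature *)

Section Variation.
Variable R : realType.
Implicit Types (f g F G : R -> R) (a b m x y V : R).

Definition monotone_between f a b :=
  (forall x y, a <= x -> x <= y -> y <= b -> f x <= f y) \/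
  (forall x y, a <= x -> x <= y -> y <= b -> f y <= f x).

(* The total variation of f on [a, b] is at most V, witnessed by a function F
   whose increments dominate those of f. *)
Definition variation_le f a b V := exists F,
  (forall x y, a <= x -> x <= y -> y <= b -> `|f y - f x| <= F y - F x) /\
  F b - F a <= V.

Lemma variation_le_monotone f a b : a <= b ->
  (forall x, a <= x <= b -> 0 <= f x <= 1) ->
  monotone_between f a b -> variation_le f a b 1.
Proof.
move=> ab f01.
have /andP[fa0 fa1] : 0 <= f a <= 1 by apply: f01; rewrite lexx.
have /andP[fb0 fb1] : 0 <= f b <= 1 by apply: f01; rewrite ab lexx.
case=> mf; [exists f | exists (fun x => - f x)]; (split=> [x y ax xy yb|]).
- by have := mf _ _ ax xy yb => ?; rewrite ger0_norm ?subr_ge0.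
- by lra.
- by have := mf _ _ ax xy yb => ?; rewrite ler0_norm ?subr_le0//; lra.
- by lra.
Qed.

Lemma variation_le_cat f a m b V1 V2 : a <= m -> m <= b ->
  variation_le f a m V1 -> variation_le f m b V2 ->
  variation_le f a b (V1 + V2).
Proof.
move=> am mb [F [Ff FV]] [G [Gf GV]].
(* The first witness is frozen beyond [m] and the second before [m], so the sum has the increments
   of [F] on the left and those of [G] on the right. *)
exists (fun x => F (Num.min x m) + G (Num.max x m)); split; last first.
  by rewrite (min_r mb) (max_l mb) (min_l am) (max_r am); lra.
move=> x y ax xy yb; have [ym|my] := leP y m.
  have xm := le_trans xy ym.
  by rewrite (min_l xm) (max_r xm); have := Ff _ _ ax xy ym; lra.
have [xm|mx] := leP x m.
  have := Ff _ _ ax xm (lexx m); have := Gf _ _ (lexx m) (ltW my) yb.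
  by have := ler_normD (f y - f m) (f m - f x); rewrite addrA subrK; lra.
by have := Gf _ _ (ltW mx) xy yb; lra.
Qed.

Lemma variation_le_eq f g a b V : (forall x, a <= x <= b -> f x = g x) ->
  variation_le f a b V -> variation_le g a b V.
Proof.
move=> fg [F [Ff FV]]; exists F; split=> // x y ax xy yb.
by rewrite -!fg ?Ff// ?ax ?yb ?(le_trans ax xy)// (le_trans xy yb).
Qed.

(** On each cell [f] stays within an increment of [F] of its value at [c j], so the cell costs at
    most [omega] times that increment, and the increments telescope. The integrals enter only as
    numbers [J j] obeying mean-value bounds. *)
Lemma quadrature_error f (b c w J : nat -> R) p omega V :
  (forall j, (j < p)%N -> b j <= c j <= b j.+1) ->
  (forall j, (j < p)%N -> 0 <= w j <= omega) ->
  (forall j m1 m2, (j < p)%N ->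
     (forall x, b j < x <= b j.+1 -> m1 <= f x <= m2) ->
     m1 * w j <= J j <= m2 * w j) ->
  0 <= omega ->
  variation_le f (b 0%N) (b p) V ->
  `|\sum_(0 <= j < p) J j - \sum_(0 <= j < p) f (c j) * w j| <= omega * V.
Proof.
move=> bc w0 Jb om0 [F [Ff FV]].
have bS j : (j < p)%N -> b j <= b j.+1.
  by move=> /bc /andP[]; exact: le_trans.
have b0 j : (j <= p)%N -> b 0%N <= b j.
  elim: j => // j ih jp; apply: le_trans (bS _ jp); exact: ih (ltnW jp).
have bp j : (j <= p)%N -> b j <= b p.
  move=> jp; rewrite -(subKn jp); elim: (p - j)%N (leq_subr j p) => [|k ih] kp.
    by rewrite subn0.
  apply: le_trans (ih (ltnW kp)).
  have -> : (p - k)%N = (p - k.+1).+1 by lia.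
  by apply: bS; lia.
have step j : (j < p)%N ->
    `|J j - f (c j) * w j| <= omega * (F (b j.+1) - F (b j)).
  move=> jp; set d := F (b j.+1) - F (b j).
  have /andP[bc1 bc2] := bc j jp; have /andP[wj0 wjo] := w0 j jp.
  have d0 : 0 <= d.
    exact: le_trans (normr_ge0 _) (Ff _ _ (b0 _ (ltnW jp)) (bS _ jp) (bp _ jp)).
  have osc x : b j < x <= b j.+1 -> f (c j) - d <= f x <= f (c j) + d.
    move=> /andP[/ltW bx xb].
    have b0j := b0 _ (ltnW jp); have bpj := bp _ jp.
    have Fm y z : b j <= y -> y <= z -> z <= b j.+1 -> `|f z - f y| <= F z - F y.
      by move=> ? yz ?; apply: Ff => //; [exact: le_trans b0j _|exact: le_trans bpj].
    suff /ler_normlP [? ?] : `|f x - f (c j)| <= d by apply/andP; split; lra.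
    (* All sub-increments of [F] in the cell are nonnegative, so the one between [x] and [c j], on
       whichever side [x] lies, is at most [d]. *)
    have F1 := le_trans (normr_ge0 _) (Fm _ _ (lexx _) bx xb).
    have F2 := le_trans (normr_ge0 _) (Fm _ _ bx xb (lexx _)).
    have F3 := le_trans (normr_ge0 _) (Fm _ _ (lexx _) bc1 bc2).
    have F4 := le_trans (normr_ge0 _) (Fm _ _ bc1 bc2 (lexx _)).
    have [xc|/ltW cx] := leP x (c j).
      rewrite distrC; have := Fm _ _ bx xc bc2; rewrite /d; lra.
    by have := Fm _ _ bc1 cx xb; rewrite /d; lra.
  have /andP[J1 J2] := Jb j _ _ jp osc.
  have : d * w j <= omega * d by rewrite mulrC ler_wpM2r.
  by rewrite ler_norml; lra.
rewrite -sumrB; apply: le_trans (ler_norm_sum _ _ _) _.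
have : \sum_(0 <= j < p) `|J j - f (c j) * w j| <=
       \sum_(0 <= j < p) omega * (F (b j.+1) - F (b j)).
  by rewrite !big_mkord; apply: ler_sum => j _; exact: step.
move=> /le_trans; apply.
by rewrite -mulr_sumr telescope_sumr// ler_wpM2l.
Qed.

End Variation.

(** * Sinusoids and the arcs they cut from a circle *)

Section Trigonometry.
Variable R : realType.
Implicit Types (f g h : R -> R) (a b m s t x y : R).

Lemma monotone_between_comp f g a b :
  {homo g : x y / x <= y} \/ {homo g : x y /~ x <= y} ->
  monotone_between f a b -> monotone_between (g \o f) a b.
Proof.
by case=> mg [mf|mf]; [left|right|right|left] => x y ax xy yb /=;
  apply: mg; apply: mf.
Qed.

Lemma monotone_between_eq f g a b : (forall x, a <= x <= b -> f x = g x) ->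
  monotone_between f a b -> monotone_between g a b.
Proof.
move=> fg [mf|mf]; [left|right] => x y ax xy yb;
  rewrite -!fg ?mf// ?(le_trans ax xy) ?(le_trans xy yb)// ?ax ?yb//.
Qed.

Lemma monotone_between_shift f a b t :
  monotone_between f a b ->
  monotone_between (fun x => f (x - t)) (a + t) (b + t).
Proof.
by case=> mf; [left|right] => x y ax xy yb; apply: mf; lra.
Qed.

Lemma subr_cos x y :
  cos y - cos x = - (2 * sin ((y - x) / 2) * sin ((x + y) / 2)).
Proof.
have -> : cos y = cos ((x + y) / 2 + (y - x) / 2) by congr cos; lra.
have -> : cos x = cos ((x + y) / 2 - (y - x) / 2) by congr cos; lra.
by rewrite cosD cosB; ring.
Qed.

Lemma subr_sin x y :
  sin y - sin x = 2 * sin ((y - x) / 2) * cos ((x + y) / 2).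
Proof.
have -> : sin y = sin ((x + y) / 2 + (y - x) / 2) by congr sin; lra.
have -> : sin x = sin ((x + y) / 2 - (y - x) / 2) by congr sin; lra.
by rewrite sinD sinB; ring.
Qed.

(** An increment of the sinusoid is a nonnegative factor times its derivative at the midpoint, and
    that derivative changes sign at most once on [[0, pi]]. *)
Lemma harmonic_monotone (u v : R) : exists2 m, 0 <= m <= pi &
  monotone_between (fun x => u * cos x + v * sin x) 0 m /\
  monotone_between (fun x => u * cos x + v * sin x) m pi.
Proof.
set h := fun x => _; have pi0 := pi_ge0 R.
(* The derivative of [h]; [hB] plays the part of the mean value theorem. *)
pose k s := v * cos s - u * sin s.
have hB x y : h y - h x = 2 * sin ((y - x) / 2) * k ((x + y) / 2).
  have := subr_cos x y; have := subr_sin x y; rewrite /h /k.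
  set A := sin (_ / 2); set B := cos (_ / 2); set C := sin (_ / 2) => e1 e2.
  have -> : u * cos y + v * sin y - (u * cos x + v * sin x) =
    u * (cos y - cos x) + v * (sin y - sin x) by ring.
  by rewrite e1 e2; ring.
have mono a b : 0 <= a -> b <= pi ->
    (forall s, a <= s <= b -> 0 <= k s) \/ (forall s, a <= s <= b -> k s <= 0) ->
    monotone_between h a b.
  move=> a0 bpi kab.
  have sn x y : a <= x -> x <= y -> y <= b -> 0 <= sin ((y - x) / 2).
    by move=> ? ? ?; apply: sin_ge0_pi; lra.
  case: kab => kab; [left|right] => x y ax xy yb.
    rewrite -subr_ge0 hB; have := sn x y ax xy yb => s0.
    by apply: mulr_ge0; [exact: mulr_ge0|apply: kab; lra].
  rewrite -subr_le0 hB; have := sn x y ax xy yb => s0.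
  by apply: mulr_ge0_le0; [exact: mulr_ge0|apply: kab; lra].
(* For [v = 0] the derivative [- u * sin s] keeps one sign and [m = 0] serves. It also vanishes at
   both ends, where the division by [sin m] below would fail. *)
have [v0|v0] := eqVneq v 0.
  exists 0; first by rewrite lexx.
  have sgn b s : b <= pi -> 0 <= s <= b -> 0 <= sin s.
    by move=> ? ?; apply: sin_ge0_pi; lra.
  have [u0|/ltW u0] := leP u 0; split; apply: mono => //; [left|left|right|right];
    move=> s sab; rewrite /k v0 mul0r sub0r ?oppr_ge0 ?oppr_le0.
  - by rewrite mulr_le0_ge0// (sgn 0).
  - by rewrite mulr_le0_ge0// (sgn pi).
  - by rewrite mulr_ge0// (sgn 0).
  - by rewrite mulr_ge0// (sgn pi).
have kc : {within `[0, pi], continuous k}.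
  apply: continuous_subspaceT => x; rewrite /k.
  apply: cvgB; apply: cvgMr; [exact: continuous_cos|exact: continuous_sin].
have [|m mpi km0] := @IVT R k 0 pi 0 pi0 kc.
  rewrite /k cos0 sin0 cospi sinpi !mulr0 !subr0 mulr1 mulrN1.
  by rewrite ge_min le_max oppr_le0 oppr_ge0 !le_total.
move: mpi; rewrite in_itv /= => mpi; exists m => //; move: mpi => /andP[m0 mpi].
have sm0 : 0 < sin m.
  rewrite lt_neqAle sin_ge0_pi ?m0// andbT eq_sym; apply/eqP => sm.
  move: km0; rewrite /k sm mulr0 subr0 => /eqP; rewrite mulf_eq0 (negbTE v0)/=.
  by move=> /eqP cm; have := cos2Dsin2 m; rewrite cm sm expr0n addr0 => /eqP;
    rewrite eq_sym oner_eq0.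
(* Since [k m = 0], [k] is a multiple of [sin (m - s)]: it has the sign of [v] before [m] and the
   opposite sign after it. *)
have ks s : k s = v * sin (m - s) / sin m.
  apply: (mulIf (lt0r_neq0 sm0)); rewrite divfK ?lt0r_neq0// sinB /k.
  have -> : (v * cos s - u * sin s) * sin m =
    v * cos s * sin m - (u * sin m) * sin s by ring.
  have -> : u * sin m = v * cos m by move: km0; rewrite /k; lra.
  by ring.
have kL s : 0 <= s <= m -> 0 <= sin (m - s) / sin m.
  by move=> ?; apply: divr_ge0; [apply: sin_ge0_pi; lra|exact: ltW].
have kR s : m <= s <= pi -> sin (m - s) / sin m <= 0.
  move=> ?; rewrite ler_pdivrMr// mul0r -opprB sinN oppr_le0; apply: sin_ge0_pi; lra.
have [vneg|/ltW vpos] := leP v 0; split; apply: mono => //;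
  [right|left|left|right] => s sab; rewrite ks -mulrA.
- by rewrite mulr_le0_ge0// kL.
- by rewrite mulr_le0// kR.
- by rewrite mulr_ge0// kL.
- by rewrite mulr_ge0_le0// kR.
Qed.

(** The 4 counts monotone pieces of a function with values 0 and 1: two on [[0, pi]] and their
    translates by [pi], where the sinusoid repeats with the opposite sign. *)
Lemma arc_variation (u v y : R) :
  variation_le (fun x => (y <= u * cos x + v * sin x)%R%:R) 0 (2 * pi) 4.
Proof.
have pi0 := pi_ge0 R.
set h := fun x => u * cos x + v * sin x.
have [m /andP[m0 mpi] [h1 h2]] := harmonic_monotone u v.
have hpi x : h x = - h (x - pi).
  by rewrite /h -{1 2}(subrK pi x) cosDpi sinDpi; ring.
have step : {homo (fun z : R => (y <= z)%R%:R : R) : x z / x <= z}.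
  move=> x z xz /=; have [yx|_] := boolP (y <= x); last by rewrite ler0n.
  by rewrite (le_trans yx xz).
have shift a b : monotone_between h a b -> monotone_between h (a + pi) (b + pi).
  move=> /(monotone_between_shift pi) mh.
  apply: (@monotone_between_eq ((@GRing.opp R) \o (fun x => h (x - pi)))).
    by move=> x _ /=; rewrite -hpi.
  by apply: monotone_between_comp => //; right => x z /=; rewrite lerN2.
have var a b : a <= b -> monotone_between h a b ->
    variation_le (fun x => (y <= h x)%R%:R) a b 1.
  move=> ab mh; apply: variation_le_monotone => //.
    by move=> x _; rewrite ler0n lern1 leq_b1.
  exact: (monotone_between_comp (or_introl step) mh).
have -> : 2 * pi = pi + pi :> R by lra.
have -> : 4 = 1 + 1 + (1 + 1) :> R by lra.
apply: (@variation_le_cat _ _ 0 pi) => //; first lra.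
  by apply: (@variation_le_cat _ _ 0 m) => //; exact: var.
apply: (@variation_le_cat _ _ pi (m + pi)); [lra|lra| |].
  by apply: var; [lra|rewrite -[X in monotone_between _ X](add0r pi); exact: shift].
by apply: var; [lra|exact: shift].
Qed.

End Trigonometry.

(** * How the level of a cap on a parallel varies with the colatitude *)

Section Levels.
Variable R : realType.
Implicit Types (f L : R -> R) (a b m s t v x y : R).

(* On the parallel of colatitude x, the half-space condition
   t <= <point, (u0, u1, v)> reads level t v x <= u0 cos theta + u1 sin theta. *)
Definition level t v x : R := (t - v * cos x) / sin x.

(** The derivative of the level has the sign of [v - t * cos x], which changes at most once. The
    proof uses increments instead, whose sign is that of [k x y]; on the diagonal [k x x] is the
    expression above. *)
Lemma level_monotone t v a b : 0 < a -> a <= b -> b < pi ->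
  exists m, [/\ a <= m <= b, monotone_between (level t v) a m &
    monotone_between (level t v) m b].
Proof.
move=> a0 ab bpi.
pose k x y := v * cos ((y - x) / 2) - t * cos ((x + y) / 2).
have GB x y : a <= x -> x <= y -> y <= b -> exists2 e,
    0 <= e & level t v y - level t v x = e * k x y.
  move=> ax xy yb.
  have sx : 0 < sin x by apply: sin_gt0_pi; lra.
  have sy : 0 < sin y by apply: sin_gt0_pi; lra.
  have sd : 0 <= sin ((y - x) / 2) by apply: sin_ge0_pi; lra.
  exists (2 * sin ((y - x) / 2) / (sin x * sin y)).
    by apply: divr_ge0; apply: mulr_ge0 => //; exact: ltW.
  have e1 := subr_sin x y.
  have e2 : sin y * cos x - cos y * sin x =
      2 * sin ((y - x) / 2) * cos ((y - x) / 2).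
    rewrite -sinB; have -> : y - x = (y - x) / 2 + (y - x) / 2 by lra.
    rewrite sinD.
    have -> : ((y - x) / 2 + (y - x) / 2) / 2 = (y - x) / 2 by lra.
    by ring.
  rewrite /level /k; move: e1 e2 sx sy.
  set A := sin (_ / 2); set B := cos (_ / 2); set C := cos (_ / 2).
  move=> e1 e2 /lt0r_neq0 sx /lt0r_neq0 sy.
  transitivity ((v * (sin y * cos x - cos y * sin x) - t * (sin y - sin x))
    / (sin x * sin y)); first by field; rewrite sx sy.
  by rewrite e1 e2; field; rewrite sx sy.
have mono c d : a <= c -> d <= b ->
    (forall x y, c <= x -> x <= y -> y <= d -> 0 <= k x y) \/
    (forall x y, c <= x -> x <= y -> y <= d -> k x y <= 0) ->
    monotone_between (level t v) c d.
  move=> ac db [kp|kn]; [left|right] => x y cx xy yd;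
    have [e e0 eq] := GB x y (le_trans ac cx) xy (le_trans yd db).
  - by rewrite -subr_ge0 eq mulr_ge0// kp.
  - by rewrite -subr_le0 eq mulr_ge0_le0// kn.
have triv c : monotone_between (level t v) c c.
  by left=> x y cx xy yc; have -> : x = y by lra.
have cle x y : 0 <= x -> x <= y -> y <= pi -> cos y <= cos x.
  by move=> x0 xy ypi; rewrite leNgt ltr_cos ?in_itv/=; lra.
(* Here the term in [v] dominates, because [(x + y) / 2] lies between [(y - x) / 2] and
   [pi - (y - x) / 2]; so [k] has the sign of [v] throughout. *)
have [tv|vt] := leP `|t| `|v|.
  exists a; rewrite lexx ab; split=> //; apply: mono => //.
  have cs x y : a <= x -> x <= y -> y <= b ->
      `|t * cos ((x + y) / 2)| <= `|v| * cos ((y - x) / 2).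
    move=> ax xy yb; rewrite normrM; apply: ler_pM => //.
    have c1 : cos ((x + y) / 2) <= cos ((y - x) / 2) by apply: cle; lra.
    have c2 : cos (pi - (y - x) / 2) <= cos ((x + y) / 2) by apply: cle; lra.
    by rewrite cosB cospi sinpi in c2; rewrite ler_norml; lra.
  have [v0|v0] := leP 0 v; [left|right] => x y ax xy yb;
    have /ler_normlP[] := cs x y ax xy yb; rewrite /k.
    by rewrite ger0_norm//; lra.
  by rewrite ltr0_norm//; lra.
have t0 : t != 0 by rewrite -normr_gt0; exact: le_lt_trans vt.
have vt1 : -1 <= v / t <= 1.
  by rewrite -ler_norml normrM normfV ler_pdivrMr ?normr_gt0// mul1r ltW.
(* The only possible turning point. The addition formulas for [m] minus or plus [(y - x) / 2] give
   the sign of [k / t] before and after it. *)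
pose m := acos (v / t).
have m0 : 0 <= m := acos_ge0 vt1.
have mpi : m <= pi := acos_lepi vt1.
have vE : v = t * cos m by rewrite /m acosK ?in_itv//= mulrC divfK.
have sm : 0 <= sin m by apply: sin_ge0_pi; rewrite m0.
have kE x y : k x y = t * (cos m * cos ((y - x) / 2) - cos ((x + y) / 2)).
  by rewrite /k vE; ring.
have sd x y : a <= x -> x <= y -> y <= b -> 0 <= sin ((y - x) / 2).
  by move=> ? ? ?; apply: sin_ge0_pi; lra.
have kL x y : a <= x -> x <= y -> y <= b -> y <= m ->
    cos m * cos ((y - x) / 2) - cos ((x + y) / 2) <= 0.
  move=> ax xy yb ym.
  have : cos (m - (y - x) / 2) <= cos ((x + y) / 2) by apply: cle; lra.
  by rewrite cosB; have := mulr_ge0 sm (sd x y ax xy yb); lra.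
have kR x y : a <= x -> x <= y -> y <= b -> m <= x ->
    0 <= cos m * cos ((y - x) / 2) - cos ((x + y) / 2).
  move=> ax xy yb mx.
  have : cos ((x + y) / 2) <= cos (m + (y - x) / 2) by apply: cle; lra.
  by rewrite cosD; have := mulr_ge0 sm (sd x y ax xy yb); lra.
have monoL d : d <= b -> d <= m -> monotone_between (level t v) a d.
  move=> db dm; apply: mono => //.
  have [t_ge0|/ltW t_le0] := leP 0 t; [right|left] => x y ax xy yd; rewrite kE.
    by rewrite mulr_ge0_le0// kL//; lra.
  by rewrite mulr_le0// kL//; lra.
have monoR c : a <= c -> m <= c -> monotone_between (level t v) c b.
  move=> ac mc; apply: mono => //.
  have [t_ge0|/ltW t_le0] := leP 0 t; [left|right] => x y cx xy yb; rewrite kE.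
    by rewrite mulr_ge0// kR//; lra.
  by rewrite mulr_le0_ge0// kR//; lra.
(* A turning point outside [[a, b]] is replaced by the nearer end, which leaves one degenerate
   piece. *)
have [ma|am] := leP m a.
  by exists a; split; [rewrite lexx|exact: triv|exact: monoR].
have [bm|mb] := leP b m.
  by exists b; split; [rewrite lexx ab|exact: monoL|exact: triv].
by exists m; split; [rewrite !ltW|apply: monoL => //; exact: ltW|
  apply: monoR => //; exact: ltW].
Qed.

(** Meant for [L] the fraction of a circle above a level: each monotone piece of the level
    contributes at most 1. *)
Lemma level_comp_variation L t v a b : 0 < a -> a <= b -> b < pi ->
  (forall y, 0 <= L y <= 1) -> {homo L : x y /~ x <= y} ->
  variation_le (L \o level t v) a b 2.
Proof.
move=> a0 ab bpi L01 Lm.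
have [m [/andP[am mb] m1 m2]] := level_monotone t v a0 ab bpi.
have -> : 2 = 1 + 1 :> R by lra.
by apply: (@variation_le_cat _ _ a m) => //; apply: variation_le_monotone => //;
  try (by move=> x _; exact: L01);
  apply: monotone_between_comp => //; right.
Qed.

End Levels.

(** * Quadrature of integrals against a weight *)

Section WeightedIntegral.
Variable R : realType.
Notation mu := (@lebesgue_measure R).
Implicit Types (f w : R -> R) (a b m V x y : R).

Lemma integrable_itv_bounded f a b : measurable_fun setT f ->
  (forall x, `|f x| <= 1) -> mu.-integrable `]a, b] (EFin \o f).
Proof.
move=> mf f1; apply: measurable_bounded_integrable => //.
- by rewrite /= lebesgue_measure_itv /=; case: ifP => // _; rewrite -EFinB ltry.
- exact: measurable_funS mf.
- exists 1; split; first by rewrite num_real.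
  by move=> y y1 x _; apply: le_trans (f1 x) (ltW y1).
Qed.

Lemma integral_weighted_between f w a b m1 m2 W :
  measurable_fun setT f -> measurable_fun setT w ->
  (forall x, 0 <= f x <= 1) -> (forall x, `|w x| <= 1) ->
  (forall x, a < x <= b -> 0 <= w x) ->
  (forall x, a < x <= b -> m1 <= f x <= m2) ->
  \int[mu]_(x in `]a, b]) w x = W ->
  m1 * W <= \int[mu]_(x in `]a, b]) (f x * w x) <= m2 * W.
Proof.
move=> mf mw f01 w1 w0 fm <-.
have iw := integrable_itv_bounded a b mw w1.
have ifw : mu.-integrable `]a, b] (EFin \o (fun x => f x * w x)).
  apply: integrable_itv_bounded; first exact: measurable_funM.
  move=> x; rewrite normrM -[1]mulr1; apply: ler_pM => //.
  by have /andP[? ?] := f01 x; rewrite ger0_norm.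
have iM m : mu.-integrable `]a, b] (EFin \o (fun x => m * w x)).
  exact: (integrableZl _ m iw).
rewrite -!RintegralZl//; apply/andP; split; apply: le_Rintegral => //;
  move=> x /=; rewrite in_itv /= => xab; have /andP[? ?] := fm x xab;
  by rewrite ler_wpM2r// w0.
Qed.

Lemma integral_itv_telescope f (b : nat -> R) p : measurable_fun setT f ->
  (forall x, `|f x| <= 1) -> (forall j, (j < p)%N -> b j <= b j.+1) ->
  \sum_(0 <= j < p) \int[mu]_(x in `]b j, b j.+1]) f x =
  \int[mu]_(x in `]b 0%N, b p]) f x.
Proof.
move=> mf f1; elim: p => [_|p ih bS].
  by rewrite big_nil set_itvoc0 Rintegral_set0.
rewrite big_nat_recr//= ih; last by move=> j jp; apply: bS; exact: ltnW.
have bp : b 0%N <= b p.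
  elim: p {ih} bS => // p ih bS; apply: le_trans (bS p _) => //.
  by apply: ih => j jp; apply: bS; exact: ltnW.
rewrite -(@Rintegral_itvB _ f (BRight (b 0%N)) (BRight (b p.+1)) (b p)) ?bnd_simp ?bS//.
  by rewrite addrC subrK.
exact: integrable_itv_bounded.
Qed.

(** Serves twice: with [w = 1] along one parallel, and with [w = sin], [W = - cos] across the
    parallels. *)
Lemma quadrature_integral f w W (b c : nat -> R) p omega V :
  measurable_fun setT f -> measurable_fun setT w ->
  (forall x, 0 <= f x <= 1) -> (forall x, `|w x| <= 1) ->
  (forall x, b 0%N < x <= b p -> 0 <= w x) ->
  (forall x y, b 0%N <= x -> x <= y -> y <= b p ->
    \int[mu]_(z in `]x, y]) w z = W y - W x) ->
  (forall j, (j < p)%N -> b j <= c j <= b j.+1) ->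
  (forall j, (j < p)%N -> W (b j.+1) - W (b j) <= omega) ->
  0 <= omega -> variation_le f (b 0%N) (b p) V ->
  `|\int[mu]_(x in `]b 0%N, b p]) (f x * w x) -
    \sum_(0 <= j < p) f (c j) * (W (b j.+1) - W (b j))| <= omega * V.
Proof.
move=> mf mw f01 w1 w0 Ww bc Wom om0 fV.
have bS j : (j < p)%N -> b j <= b j.+1.
  by move=> /bc /andP[]; exact: le_trans.
have b0 j : (j <= p)%N -> b 0%N <= b j.
  elim: j => // j ih jp; apply: le_trans (bS _ jp); exact: ih (ltnW jp).
have bp j : (j <= p)%N -> b j <= b p.
  move=> jp; rewrite -(subKn jp); elim: (p - j)%N (leq_subr j p) => [|k ih] kp.
    by rewrite subn0.
  apply: le_trans (ih (ltnW kp)).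
  have -> : (p - k)%N = (p - k.+1).+1 by lia.
  by apply: bS; lia.
have wj j x : (j < p)%N -> b j < x <= b j.+1 -> 0 <= w x.
  move=> jp /andP[jx xj]; apply: w0.
  by rewrite (le_lt_trans (b0 _ (ltnW jp)) jx) (le_trans xj (bp _ jp)).
rewrite -(integral_itv_telescope _ _ bS); last 2 first.
- exact: measurable_funM.
- move=> x; rewrite normrM -[1]mulr1; apply: ler_pM => //.
  by have /andP[? ?] := f01 x; rewrite ger0_norm.
have jW j : (j < p)%N -> \int[mu]_(x in `]b j, b j.+1]) w x = W (b j.+1) - W (b j).
  by move=> jp; apply: Ww; [exact/b0/ltnW|exact: bS|exact: bp].
apply: (quadrature_error (b := b)) => // [j jp|j m1 m2 jp fm].
  rewrite Wom// andbT -jW//; apply: Rintegral_ge0 => x /=.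
  by rewrite in_itv /=; exact: wj.
by apply: integral_weighted_between => //; [move=> x; exact: wj|exact: jW].
Qed.

Lemma integral_sin a b : a <= b ->
  \int[mu]_(x in `]a, b]) sin x = cos a - cos b.
Proof.
rewrite le_eqVlt => /predU1P[->|ab].
  by rewrite set_itvoc0 Rintegral_set0 subrr.
have ms : measurable_fun setT (@sin R).
  by apply: continuous_measurable_fun; exact: continuous_sin.
rewrite Rintegral_itv_obnd_cbnd; last first.
  by apply: integrable_itv_bounded => // x; exact: sin_max.
rewrite /Rintegral (@continuous_FTC2 _ _ (- (@cos R)))//=.
- by rewrite opprK addrC.
- by apply: continuous_subspaceT => x; exact: continuous_sin.
- split.
  + by move=> x _; exact: derivableN.
  + by apply: cvg_at_right_filter; apply: cvgN; exact: continuous_cos.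
  + by apply: cvg_at_left_filter; apply: cvgN; exact: continuous_cos.
- by move=> x _; rewrite derive1E deriveN// derive_val opprK.
Qed.

Lemma integral_one a b : a <= b -> \int[mu]_(x in `]a, b]) 1 = b - a.
Proof.
rewrite le_eqVlt => /predU1P[->|ab].
  by rewrite set_itvoc0 Rintegral_set0 subrr.
by rewrite Rintegral_cst//= lebesgue_measure_itv /= lte_fin ab mul1r.
Qed.

End WeightedIntegral.

(** * Equally spaced points on an arc of a circle *)

Section Parallels.
Variable R : realType.
Notation mu := (@lebesgue_measure R).
Implicit Types (u v x y theta : R).

Definition arc_indicator u v y x : R := (y <= u * cos x + v * sin x)%R%:R.

Definition arc_fraction u v y : R :=
  (2 * pi)^-1 * \int[mu]_(x in `]0, 2 * pi]) arc_indicator u v y x.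

Lemma measurable_arc_indicator u v y : measurable_fun setT (arc_indicator u v y).
Proof.
have -> : arc_indicator u v y =
    fun x => if y <= u * cos x + v * sin x then 1 else 0.
  by apply/funext => x; rewrite /arc_indicator; case: ifP.
apply: measurable_fun_ifT => //.
apply: measurable_fun_ler => //; apply: continuous_measurable_fun => x.
by apply: cvgD; apply: cvgMr; [exact: continuous_cos|exact: continuous_sin].
Qed.

Lemma arc_indicator01 u v y x : 0 <= arc_indicator u v y x <= 1.
Proof. by rewrite ler0n lern1 leq_b1. Qed.

Lemma norm_arc_indicator u v y x : `|arc_indicator u v y x| <= 1.
Proof. by have /andP[? ?] := arc_indicator01 u v y x; rewrite ger0_norm. Qed.

Let tau_gt0 : 0 < 2 * pi :> R.
Proof. by rewrite mulr_gt0// pi_gt0. Qed.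

Lemma integrable_arc_indicator u v y :
  mu.-integrable `]0, 2 * pi] (EFin \o arc_indicator u v y).
Proof.
apply: integrable_itv_bounded; first exact: measurable_arc_indicator.
exact: norm_arc_indicator.
Qed.

Lemma arc_fraction_le u v x y : x <= y -> arc_fraction u v y <= arc_fraction u v x.
Proof.
move=> xy; rewrite ler_pM2l ?invr_gt0//.
apply: le_Rintegral => //; do ?exact: integrable_arc_indicator.
move=> z _; rewrite /arc_indicator; have [yz|_] := boolP (y <= _); last exact: ler0n.
by rewrite (le_trans xy yz).
Qed.

Lemma arc_fraction01 u v y : 0 <= arc_fraction u v y <= 1.
Proof.
rewrite mulr_ge0 ?invr_ge0 ?(ltW tau_gt0)//=; last first.
  by apply: Rintegral_ge0 => x _; have /andP[] := arc_indicator01 u v y x.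
rewrite /arc_fraction mulrC ler_pdivrMr// mul1r -[leRHS]subr0 -integral_one ?(ltW tau_gt0)//.
apply: le_Rintegral => //; first exact: integrable_arc_indicator.
  by apply: integrable_itv_bounded => // x; rewrite normr1.
by move=> x _; have /andP[] := arc_indicator01 u v y x.
Qed.

Lemma sum_periodic_shift (g : nat -> R) r k : (forall i, g (i + r)%N = g i) ->
  \sum_(0 <= i < r) g (i + k)%N = \sum_(0 <= i < r) g i.
Proof.
move=> gr; elim: k => [|k <-]; first by apply: eq_bigr => i _; rewrite addn0.
under eq_bigr do rewrite addnS -addSn.
rewrite -[LHS](big_add1 _ _ 0%N r.+1 xpredT (fun i => g (i + k)%N)).
(* The term of index [k], added to both sides, is the first of [r + 1] consecutive terms on the left
   and, by periodicity, the last of them on the right. *)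
apply: (addrI (g (0 + k)%N)); rewrite -big_ltn// big_nat_recr//=.
by rewrite addrC addnC gr add0n.
Qed.

(** The count is a Riemann sum of step [h = 2 * pi / r] for the length of the arcs. Its error is at
    most [h] times the variation 4, and dividing by [h] returns to a count. *)
Lemma arc_count u v y theta r : (0 < r)%N -> 0 <= theta ->
  `|\sum_(1 <= i < r.+1) arc_indicator u v y (2 * pi * i%:R / r%:R + theta)
    - r%:R * arc_fraction u v y| <= 4.
Proof.
move=> r0 theta0; set f := arc_indicator u v y.
have r0' : 0 < r%:R :> R by rewrite ltr0n.
have rN0 : r%:R != 0 :> R := lt0r_neq0 r0'.
have tauN0 : 2 * pi != 0 :> R := lt0r_neq0 tau_gt0.
pose h := 2 * pi / r%:R : R.
have h0 : 0 < h by rewrite divr_gt0.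
(* Subtracting k steps from theta moves the sample points, up to a cyclic
   relabelling, into the cells ]h j, h (j + 1)]. *)
pose k := Num.truncn (theta / h); pose eps := theta - h * k%:R.
have /andP[eps0 epsh] : 0 <= eps < h.
  have : 0 <= theta / h by rewrite divr_ge0// ltW.
  move=> /Num.Theory.truncn_itv; rewrite -/k ler_pdivlMr// ltr_pdivrMr//.
  by rewrite -natr1 /eps; lra.
pose g i := f (h * i%:R + eps).
have gr i : g (i + r)%N = g i.
  rewrite /g /f /arc_indicator natrD mulrDr divfK// addrAC.
  by rewrite mulr_natl cosD2pi sinD2pi.
have -> : \sum_(1 <= i < r.+1) f (2 * pi * i%:R / r%:R + theta) =
    \sum_(0 <= i < r) g i.
  (* The shift is [k.+1]: [k] steps were taken from [theta], and one more comes from [i] starting at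
     1. *)
  rewrite big_add1 /= -(sum_periodic_shift k.+1 gr); apply: eq_bigr => i _.
  rewrite /g; congr f; rewrite /eps addnS -addSn natrD /h; lra.
have hr : h * r%:R = 2 * pi by rewrite divfK.
have := @quadrature_integral R f (fun=> 1) id (fun j => h * j%:R)
  (fun j => h * j%:R + eps) r h 4.
rewrite /= mulr0 hr; under eq_Rintegral do rewrite mulr1.
have -> : \sum_(0 <= j < r) f (h * j%:R + eps) * (h * j.+1%:R - h * j%:R) =
    h * \sum_(0 <= i < r) g i.
  by rewrite mulr_sumr; apply: eq_bigr => i _; rewrite -natr1 /g; ring.
have -> : \int[mu]_(x in `]0, 2 * pi]) f x = h * (r%:R * arc_fraction u v y).
  by rewrite mulrA hr mulrA mulfV// mul1r.
rewrite -mulrBr normrM (gtr0_norm h0) distrC => H.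
rewrite -(ler_pM2l h0); apply: H => //.
- exact: measurable_arc_indicator.
- exact: arc_indicator01.
- by move=> x; rewrite normr1.
- by move=> x z _ xz _; exact: integral_one.
- by move=> j _; rewrite -natr1; apply/andP; split; lra.
- by move=> j _; rewrite -natr1; lra.
- exact: ltW.
- exact: arc_variation.
Qed.

End Parallels.

(** * Surface measure of a cap by slices of constant colatitude *)

Section SurfaceMeasure.
Variable R : realType.
Notation mu := (@lebesgue_measure R).
Implicit Types (u v t x y a b c : R).

Lemma dot_point3 a b c (u : 'rV[R]_3) :
  dot (point3 a b c) u = a * u 0 0 + b * u 0 1 + c * u 0 2%:R.
Proof.
rewrite /dot !big_ord_recr big_ord0 /= add0r !mxE /=.
by congr (_ * u 0 _ + _ * u 0 _ + _ * u 0 _); exact: val_inj.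
Qed.

Lemma dot_point3_self a b c :
  dot (point3 a b c) (point3 a b c) = a ^+ 2 + b ^+ 2 + c ^+ 2.
Proof. by rewrite dot_point3 !mxE /= -!expr2. Qed.

(** The half-space condition in colatitude [w.1] and longitude [w.2], free of division by [sin w.1]
    so that it stays correct at the poles. *)
Definition zone_indicator u0 u1 v t (w : R * R) : R :=
  (t <= sin w.1 * (u0 * cos w.2 + u1 * sin w.2) + v * cos w.1)%R%:R.

(* The fraction of the parallel of colatitude x inside the cap
   t <= <point, (u0, u1, v)>. *)
Definition zone_fraction u0 u1 v t x : R :=
  (2 * pi)^-1 * \int[mu]_(y in `]0, 2 * pi]) zone_indicator u0 u1 v t (x, y).

Lemma zone_fractionE u0 u1 v t x : 0 < sin x ->
  zone_fraction u0 u1 v t x = arc_fraction u0 u1 (level t v x).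
Proof.
move=> sx; rewrite /zone_fraction /arc_fraction; congr (_ * _).
apply: eq_Rintegral => y _; rewrite /zone_indicator /arc_indicator /level /=.
by rewrite ler_pdivrMr// lerBlDr mulrC.
Qed.

Lemma zone_indicator01 u0 u1 v t w : 0 <= zone_indicator u0 u1 v t w <= 1.
Proof. by rewrite ler0n lern1 leq_b1. Qed.

Lemma measurable_zone_indicator u0 u1 v t :
  measurable_fun setT (zone_indicator u0 u1 v t).
Proof.
have -> : zone_indicator u0 u1 v t = fun w =>
    if t <= sin w.1 * (u0 * cos w.2 + u1 * sin w.2) + v * cos w.1 then 1 else 0.
  by apply/funext => w; rewrite /zone_indicator; case: ifP.
have ms : measurable_fun setT (@sin R).
  by apply: continuous_measurable_fun; exact: continuous_sin.
have mc : measurable_fun setT (@cos R).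
  by apply: continuous_measurable_fun; exact: continuous_cos.
have m1 (f : R -> R) : measurable_fun setT f ->
    measurable_fun setT (fun w : R * R => f w.1).
  by move=> mf; exact: measurableT_comp.
have m2 (f : R -> R) : measurable_fun setT f ->
    measurable_fun setT (fun w : R * R => f w.2).
  by move=> mf; exact: measurableT_comp.
apply: measurable_fun_ifT => //; apply: measurable_fun_ler => //.
apply: measurable_funD; apply: measurable_funM => //; try exact: m1.
by apply: measurable_funD; apply: measurable_funM => //; exact: m2.
Qed.

Lemma measurable_zone_slice u0 u1 v t x :
  measurable_fun setT (fun y => zone_indicator u0 u1 v t (x, y)).
Proof.
exact: (measurableT_comp (measurable_zone_indicator u0 u1 v t)
  (measurable_pair1 x)).
Qed.

Lemma norm_zone_indicator u0 u1 v t w : `|zone_indicator u0 u1 v t w| <= 1.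
Proof.
by have /andP[? ?] := zone_indicator01 u0 u1 v t w; rewrite ger0_norm.
Qed.

Lemma zone_fraction01 u0 u1 v t x : 0 <= zone_fraction u0 u1 v t x <= 1.
Proof.
have tau0 : 0 < 2 * pi :> R by rewrite mulr_gt0// pi_gt0.
apply/andP; split.
  rewrite mulr_ge0 ?invr_ge0 ?(ltW tau0)//=; apply: Rintegral_ge0 => y _.
  by have /andP[] := zone_indicator01 u0 u1 v t (x, y).
rewrite /zone_fraction mulrC ler_pdivrMr// mul1r -[leRHS]subr0.
rewrite -integral_one ?(ltW tau0)//; apply: le_Rintegral => //.
- apply: integrable_itv_bounded; first exact: measurable_zone_slice.
  by move=> y; exact: norm_zone_indicator.
- by apply: integrable_itv_bounded => // y; rewrite normr1.
- by move=> y _; have /andP[] := zone_indicator01 u0 u1 v t (x, y).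
Qed.

(** Bridges two conventions: the surface integral has closed intervals and extended real values, the
    quadrature half-open intervals and real values. *)
Lemma integral_zone_slice u0 u1 v t x :
  (\int[mu]_(y in `[0%R, (2 * pi)%R]) (zone_indicator u0 u1 v t (x, y))%:E =
   (2 * pi * zone_fraction u0 u1 v t x)%:E)%E.
Proof.
have tauN0 : 2 * pi != 0 :> R by rewrite mulf_neq0// lt0r_neq0// pi_gt0.
rewrite /zone_fraction mulrA mulfV// mul1r /Rintegral.
have iz : mu.-integrable `]0, 2 * pi]
    (EFin \o (fun y => zone_indicator u0 u1 v t (x, y))).
  apply: integrable_itv_bounded; first exact: measurable_zone_slice.
  by move=> y; exact: norm_zone_indicator.
rewrite fineK; last exact: integrable_fin_num.
rewrite integral_itv_obnd_cbnd//; exact: measurable_int iz.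
Qed.

(** By Tonelli: up to the factor [2 * pi] this is a partial integral of a nonnegative measurable
    function of two variables. *)
Lemma measurable_zone_fraction u0 u1 v t :
  measurable_fun setT (zone_fraction u0 u1 v t).
Proof.
pose f := (fun w : R * R => (zone_indicator u0 u1 v t w)%:E)
  \_ (setT `*` `[0, 2 * pi]).
have mD : measurable (setT `*` `[0%R, (2 * pi)%R] : set (R * R)).
  exact: measurableX.
have mf : measurable_fun setT f.
  apply/(measurable_restrictT _ mD)/measurable_funTS/measurable_EFinP.
  exact: measurable_zone_indicator.
have f0 w : (0 <= f w)%E.
  rewrite /f patchE; case: ifP => // _.
  by rewrite lee_fin; have /andP[] := zone_indicator01 u0 u1 v t w.
have := @measurable_fun_fubini_tonelli_F _ _ (measurableTypeR R)
  (measurableTypeR R) R mu f mf f0.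
rewrite [X in measurable_fun _ X -> _](_ : _ =
    fun x => (2 * pi * zone_fraction u0 u1 v t x)%:E); last first.
  apply/funext => x; rewrite /fubini_F -integral_zone_slice [RHS]integral_mkcond.
  apply: eq_integral => y _; rewrite /f !patchE.
  congr (if _ then _ else _); apply/idP/idP; rewrite !inE //=; by case.
move=> /measurable_EFinP m2f.
have -> : zone_fraction u0 u1 v t =
    fun x => (2 * pi)^-1 * (2 * pi * zone_fraction u0 u1 v t x).
  apply/funext => x; rewrite mulKf// mulf_neq0// lt0r_neq0// pi_gt0//.
exact: measurable_funM.
Qed.

Lemma cap_spherical_coordinates (u : 'rV[R]_3) t (w : R * R) :
  \1_(spherical_cap u t) (spherical_coordinates w.1 w.2) =
  zone_indicator (u 0 0) (u 0 1) (u 0 2%:R) t w.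
Proof.
rewrite indicE /zone_indicator; congr (_%:R); congr nat_of_bool.
have -> : sin w.1 * (u 0 0 * cos w.2 + u 0 1 * sin w.2) + u 0 2%:R * cos w.1 =
    dot (spherical_coordinates w.1 w.2) u by rewrite dot_point3; ring.
apply/idP/idP; rewrite inE /spherical_cap /=; first by case.
move=> tu; split=> //.
rewrite /sphere2 /= dot_point3_self !exprMn -mulrDr [_ + sin _ ^+ 2]cos2Dsin2.
by rewrite mulr1 addrC cos2Dsin2.
Qed.

(** Integrating the longitude first gives [2 * pi] times the fraction; against the total area
    [4 * pi] a factor one half remains. *)
Lemma surface_measure_cap (u : 'rV[R]_3) t :
  fine (surface_measure (spherical_cap u t)) / (4 * pi) =
  2^-1 * \int[mu]_(x in `]0, pi])
    (zone_fraction (u 0 0) (u 0 1) (u 0 2%:R) t x * sin x).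
Proof.
set z := zone_fraction _ _ _ _.
pose g (w : R * R) := zone_indicator (u 0 0) (u 0 1) (u 0 2%:R) t w * sin w.1.
pose D := `[0, pi] `*` `[0, 2 * pi] : set (R * R).
have mD : measurable D by exact: measurableX.
have ms : measurable_fun setT (@sin R).
  by apply: continuous_measurable_fun; exact: continuous_sin.
have pi0 := pi_gt0 R.
(* Extension by zero outside the parameter rectangle; inside it [sin w.1] is nonnegative, as Tonelli
   requires. *)
pose f := (fun w : R * R => (g w)%:E) \_ D.
have mf : measurable_fun setT f.
  apply/(measurable_restrictT _ mD)/measurable_funTS/measurable_EFinP.
  apply: measurable_funM; first exact: measurable_zone_indicator.
  exact: measurableT_comp.
have f0 w : (0 <= f w)%E.
  rewrite /f patchE; case: ifPn => //. rewrite inE => -[/= + _].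
  rewrite in_itv /= => w1; rewrite lee_fin mulr_ge0// ?sin_ge0_pi//.
have iz : mu.-integrable `]0, pi] (EFin \o (fun x => z x * sin x)).
  apply: integrable_itv_bounded.
    by apply: measurable_funM => //; exact: measurable_zone_fraction.
  move=> x; rewrite normrM -[1]mulr1; apply: ler_pM => //; last exact: sin_max.
  have /andP[? ?] := zone_fraction01 (u 0 0) (u 0 1) (u 0 2%:R) t x.
  by rewrite ger0_norm.
have -> : surface_measure (spherical_cap u t) =
    (\int[mu]_(x in `[0%R, pi]) (2 * pi * (z x * sin x))%:E)%E.
  rewrite /surface_measure.
  under eq_integral do rewrite cap_spherical_coordinates.
  rewrite integral_mkcond -/D -/f (@fubini_tonelli1 _ _
    (measurableTypeR R) (measurableTypeR R) R mu mu f mf f0) [RHS]integral_mkcond.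
  apply: eq_integral => x _; rewrite /fubini_F patchE.
  case: ifPn => [|xN]; last first.
    apply: integral0_eq => y _; rewrite /f patchE ifN//.
    by apply: contra xN; rewrite !inE => -[].
  rewrite inE /= => xpi.
  have sx : 0 <= sin x by rewrite sin_ge0_pi//; move: xpi; rewrite in_itv.
  rewrite mulrA EFinM -[X in (X * _)%E]integral_zone_slice.
  rewrite -ge0_integralZr//; last 2 first.
  - apply/measurable_EFinP/measurable_funTS; exact: measurable_zone_slice.
  - move=> y _; rewrite lee_fin.
    by have /andP[] := zone_indicator01 (u 0 0) (u 0 1) (u 0 2%:R) t (x, y).
  rewrite [RHS]integral_mkcond; apply: eq_integral => y _; rewrite /f !patchE.
  congr (if _ then _ else _); apply/idP/idP; rewrite !inE //=; by case.
rewrite -integral_itv_obnd_cbnd; last first.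
  apply/measurable_EFinP/measurable_funTS/measurable_funM => //.
  apply: measurable_funM => //; exact: measurable_zone_fraction.
under eq_integral do rewrite EFinM.
rewrite integralZl//= -[in LHS](fineK (integrable_fin_num _ iz))//=.
have e (q I : R) : q != 0 -> 2 * q * I / (4 * q) = 2^-1 * I.
  by move=> q0; field.
exact: e (lt0r_neq0 pi0).
Qed.

End SurfaceMeasure.

(** * Size of the numbers [r_j] and of [N] *)

Section ParameterBounds.
Variables (R : realType) (P : diamond_parameters R) (M : nat).
Hypothesis PM : dM P M.

Local Notation n := (dn P).
Local Notation t := (dt P M).
Local Notation alpha := (dalpha P M).
Local Notation beta := (dbeta P M).
Local Notation A := (dA P).
Local Notation c := (dc P).

Let M0 : (0 < M)%N := dM_gt0 PM.

Lemma dt_homo l m : (l <= m)%N -> (m <= n)%N -> (t l <= t m)%N.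
Proof.
move=> lm; rewrite -(subnKC lm); elim: (m - l)%N => [|k ih] mn.
  by rewrite addn0.
have /= := @dt_incr _ P M (l + k.+1) PM; rewrite addnS /= in mn *.
by move=> /(_ mn); have := ih (ltnW mn); lia.
Qed.

Lemma dr_piece_nat l j : (1 <= l <= n)%N -> (t l.-1 <= j <= t l)%N ->
  dr P M j%:R = (alpha l + beta l * j)%:R.
Proof.
move=> ln /andP[tj jt].
by rewrite (dr_piece PM ln) ?ler_nat ?tj// natrD natrM.
Qed.

Lemma piece_exists j : (j <= M)%N ->
  exists2 l, (1 <= l <= n)%N & (t l.-1 <= j <= t l)%N.
Proof.
move=> jM; have {jM} : (j <= t n)%N by rewrite (dt_last PM).
suff H l : (l <= n)%N -> (j <= t l)%N ->
  exists2 l, (1 <= l <= n)%N & (t l.-1 <= j <= t l)%N by exact: (H n).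
elim: l => [_ j0|l ih ln jl].
  exists 1%N; first by rewrite (dn_gt0 P).
  by rewrite /= (dt_first PM) in j0 *; move: j0; lia.
have [jt|tj] := leqP j (t l); first exact: ih (ltnW ln) jt.
by exists l.+1; rewrite ?ln//= jl ltnW.
Qed.

(** Induction on the nodes: the first slope is at least 1, consecutive pieces agree at their common
    node, and all slopes are nonnegative. *)
Lemma node_value_ge l : (1 <= l <= n)%N -> (t 1 <= alpha l + beta l * t l)%N.
Proof.
have tl k : (1 <= k <= n)%N -> (t k.-1 <= t k)%N.
  by move=> kn; apply: dt_homo; lia.
case: l => // l; elim: l => [|l ih] ln.
  by have := dbeta_first PM; nia.
have /ih ln' : (1 <= l.+1 <= n)%N by lia.
apply: leq_trans ln' _.
have l1n : (1 <= l.+1 <= n)%N by lia.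
have -> : (alpha l.+1 + beta l.+1 * t l.+1 =
           alpha l.+2 + beta l.+2 * t l.+1)%N.
  apply/eqP; rewrite -(eqr_nat R) -(dr_piece_nat l1n); last first.
    by rewrite leqnn tl.
  by rewrite -(dr_piece_nat ln)//= leqnn /=; exact: (tl _ ln).
by rewrite leq_add2l leq_mul2l (tl _ ln) orbT.
Qed.

(** On the first piece the slope is at least 1, which gives at least [j]; later pieces start from a
    node value of at least [t 1] and do not decrease. Above, intercept and slope term are at most
    [A M] each. *)
Lemma dr_nat j : (j <= M)%N -> exists k,
  [/\ dr P M j%:R = k%:R, (minn j (t 1) <= k)%N & k%:R <= 2 * A * M%:R].
Proof.
move=> jM; have [l ln tj] := piece_exists jM.
exists (alpha l + beta l * j)%N; split; first exact: dr_piece_nat.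
  case: l ln tj => [//|[|l]] ln tj.
    by have := dbeta_first PM; nia.
  have l1 : (1 <= l.+1 <= n)%N by lia.
  apply: leq_trans (geq_minr _ _) _; apply: leq_trans (node_value_ge l1) _.
  have tl : (t l <= t l.+1 <= t l.+1)%N by rewrite leqnn andbT; apply: dt_homo; lia.
  have tl' : (t l.+1 <= t l.+1 <= t l.+2)%N by rewrite leqnn /=; apply: dt_homo; lia.
  have -> : (alpha l.+1 + beta l.+1 * t l.+1 =
             alpha l.+2 + beta l.+2 * t l.+1)%N.
    by apply/eqP; rewrite -(eqr_nat R) -(dr_piece_nat l1)// -(dr_piece_nat ln).
  by rewrite leq_add2l leq_mul2l; case/andP: tj => /= -> _; rewrite orbT.
rewrite natrD natrM; have a1 := dalpha_le PM ln; have b1 := dbeta_le PM ln.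
have : (beta l)%:R * j%:R <= A * M%:R :> R by apply: ler_pM => //; rewrite ler_nat.
by lra.
Qed.

(** A natural number, so that it can bound an index; the truncation is exact for [1 <= j <= p],
    where [r_j] is a natural number. *)
Definition diamond_rn j := Num.truncn (diamond_r P M j).
Local Notation p := (diamond_p M).

Lemma diamond_r_sym j : (j <= 2 * M)%N ->
  diamond_r P M (2 * M - j) = diamond_r P M j.
Proof.
move=> jM; rewrite /diamond_r [RHS](dr_sym PM).
  by rewrite natrB// natrM.
by rewrite ler0n -natrM ler_nat.
Qed.

Lemma diamond_r_nat j : (j <= 2 * M)%N -> exists k,
  [/\ diamond_r P M j = k%:R, (minn (minn j (2 * M - j)) (t 1) <= k)%N &
      k%:R <= 2 * A * M%:R].
Proof.
move=> jM; have [jM'|Mj] := leqP j M.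
  have [k [kE k1 k2]] := dr_nat jM'; exists k; split=> //.
  by apply: leq_trans k1; lia.
have j' : (2 * M - j <= M)%N by lia.
have [k [kE k1 k2]] := dr_nat j'; exists k; split=> //.
  by rewrite -diamond_r_sym.
by apply: leq_trans k1; lia.
Qed.

Lemma dt1_gt0 : (0 < t 1)%N.
Proof.
have := @dt_incr _ P M 1 PM; rewrite /= (dt_first PM); apply.
by rewrite (dn_gt0 P).
Qed.

Lemma diamond_rnE j : (1 <= j <= p)%N -> diamond_r P M j = (diamond_rn j)%:R.
Proof.
rewrite /diamond_p => jp; have [|k [kE _ _]] := @diamond_r_nat j; first lia.
by rewrite /diamond_rn kE natrK.
Qed.

Lemma diamond_rn_gt0 j : (1 <= j <= p)%N -> (0 < diamond_rn j)%N.
Proof.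
rewrite /diamond_p => jp; have [|k [kE k1 _]] := @diamond_r_nat j; first lia.
rewrite /diamond_rn kE natrK; apply: leq_trans k1; have := dt1_gt0; lia.
Qed.

Lemma diamond_r_gt0 j : (1 <= j <= p)%N -> 0 < diamond_r P M j.
Proof. by move=> jp; rewrite diamond_rnE// ltr0n diamond_rn_gt0. Qed.

Lemma diamond_r_le j : (1 <= j <= p)%N -> diamond_r P M j <= 2 * A * M%:R.
Proof.
rewrite /diamond_p => jp; have [|k [kE _ k2]] := @diamond_r_nat j; first lia.
by rewrite kE.
Qed.

Lemma dt1_le : (t 1 <= M)%N.
Proof. by rewrite -[leqRHS](dt_last PM); apply: dt_homo => //; exact: dn_gt0. Qed.

Lemma diamond_r_equator : c * M%:R <= diamond_r P M M.
Proof.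
have [|k [-> k1 _]] := @diamond_r_nat M; first lia.
apply: le_trans (dt_ge PM) _; rewrite ler_nat; apply: leq_trans k1.
by have := dt1_le; lia.
Qed.

Lemma diamond_NE : diamond_N P M = 2 + \sum_(1 <= j < 2 * M) diamond_r P M j.
Proof. by rewrite /diamond_N /diamond_p; have -> : (2 * M - 1).+1 = (2 * M)%N by lia. Qed.

(** The first [t 1] parallels carry at least [1, 2, ..., t 1] points, so at least half the square of
    [t 1] in total, and [t 1] is at least [c M]. *)
Lemma diamond_N_ge : (c * M%:R) ^+ 2 <= 2 * diamond_N P M.
Proof.
have t1M := dt1_le; have t10 := dt1_gt0.
have c0 := dc_gt0 P.
have gauss m : m%:R ^+ 2 <= 2 * \sum_(1 <= i < m.+1) i%:R :> R.
  elim: m => [|m ih]; first by rewrite expr0n /= mulr_ge0// sumr_ge0.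
  rewrite big_nat_recr//= mulrDr; have : 0 <= m%:R :> R by [].
  by rewrite -natr1; lra.
have sum_ge : \sum_(1 <= i < (t 1).+1) i%:R <=
    \sum_(1 <= j < 2 * M) diamond_r P M j.
  have [t2M|] := leqP (t 1).+1 (2 * M)%N; last by lia.
  rewrite [leRHS](@big_cat_nat _ _ _ (t 1).+1)//=.
  rewrite -[leLHS]addr0; apply: lerD.
    rewrite big_nat_cond [leRHS]big_nat_cond; apply: ler_sum => i.
    rewrite andbT => it; have [|k [-> k1 _]] := @diamond_r_nat i; first lia.
    by rewrite ler_nat; apply: leq_trans k1; lia.
  rewrite big_nat_cond; apply: sumr_ge0 => i; rewrite andbT => it.
  by apply/ltW/diamond_r_gt0; rewrite /diamond_p; lia.
apply: le_trans (_ : (t 1)%:R ^+ 2 <= _).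
  by rewrite ler_sqr ?nnegrE ?mulr_ge0 ?(ltW c0)//; exact: dt_ge PM.
apply: le_trans (gauss _) _.
by rewrite diamond_NE; lra.
Qed.

(** There are [2 M - 1] parallels with at most [2 A M] points each; the slack absorbs the two
    poles. *)
Lemma diamond_N_le : diamond_N P M <= (2 * A * M%:R) ^+ 2.
Proof.
have A2 := dA_ge2 P; have M1 : 1 <= M%:R :> R by rewrite ler1n.
have S : \sum_(1 <= j < 2 * M) diamond_r P M j <= (2 * M%:R - 1) * (2 * A * M%:R).
  have -> : (2 * M%:R - 1) * (2 * A * M%:R) =
      \sum_(1 <= j < 2 * M) (2 * A * M%:R) :> R.
    by rewrite sumr_const_nat -[RHS]mulr_natl natrB ?muln_gt0// natrM.
  rewrite big_nat_cond [leRHS]big_nat_cond; apply: ler_sum => i.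
  by rewrite andbT => iM; apply: diamond_r_le; rewrite /diamond_p; lia.
by rewrite diamond_NE; nra.
Qed.

End ParameterBounds.

(** * Heights of the parallels and enumeration of the points *)

Section DiamondPoints.
Variables (R : realType) (P : diamond_parameters R) (M : nat).
Hypothesis PM : dM P M.

Local Notation r := (diamond_r P M).
Local Notation rn := (diamond_rn P M).
Local Notation N := (diamond_N P M).
Local Notation p := (diamond_p M).
Local Notation z := (diamond_z P M).

Let M0 : (0 < M)%N := dM_gt0 PM.

(* The lower edge of the zone of area 4 pi r_j / (N - 1) that has the j-th
   parallel as its middle height; j = 0 gives the edge of the northern cap. *)
Definition diamond_cut j : R := 1 - (1 + 2 * \sum_(1 <= k < j.+1) r k) / (N - 1).
Local Notation cut := diamond_cut.

Lemma diamond_N_gt2 : 2 < N.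
Proof.
rewrite diamond_NE// ltrDl big_ltn; last lia.
apply: ltr_pwDl; first by apply: diamond_r_gt0 => //; rewrite /diamond_p; lia.
rewrite big_nat_cond; apply: sumr_ge0 => i; rewrite andbT => iM.
by apply/ltW/diamond_r_gt0 => //; rewrite /diamond_p; lia.
Qed.

(** With [diamond_cutS], this puts each parallel half way in height between two consecutive cuts. *)
Lemma diamond_z_cut j : z j.+1 = cut j - r j.+1 / (N - 1).
Proof. by rewrite /diamond_z /cut; ring. Qed.

Lemma diamond_cutS j : cut j.+1 = z j.+1 - r j.+1 / (N - 1).
Proof. by rewrite /diamond_z /cut big_nat_recr//=; ring. Qed.

Lemma diamond_cut0 : cut 0 = 1 - (N - 1)^-1.
Proof. by rewrite /cut big_geq// mulr0 addr0 mul1r. Qed.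

Lemma diamond_cut_last : cut p = - 1 + (N - 1)^-1.
Proof.
have N2 := diamond_N_gt2; have N1 : N - 1 != 0 by apply/lt0r_neq0; lra.
have -> : cut p = 1 - (1 + 2 * (N - 2)) / (N - 1).
  by rewrite /cut /diamond_N; congr (1 - (1 + 2 * _) / _); ring.
by field.
Qed.

Let r_over_gt0 j : (j < p)%N -> 0 < r j.+1 / (N - 1).
Proof.
move=> jp; apply: divr_gt0; first by apply: diamond_r_gt0.
by have := diamond_N_gt2; lra.
Qed.

Lemma diamond_cut_homo j k : (j <= k)%N -> (k <= p)%N -> cut k <= cut j.
Proof.
move=> jk; rewrite -(subnKC jk); elim: (k - j)%N => [|d ih] kp.
  by rewrite addn0.
move: kp; rewrite addnS => kp; apply: le_trans (ih (ltnW kp)).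
by rewrite diamond_cutS diamond_z_cut; have := r_over_gt0 kp; lra.
Qed.

Lemma diamond_cut_itv j : (j <= p)%N -> -1 < cut j < 1.
Proof.
move=> jp; have N2 := diamond_N_gt2.
have Ni : 0 < (N - 1)^-1 by rewrite invr_gt0; lra.
have := diamond_cut_homo (leq0n j) jp; have := diamond_cut_homo jp (leqnn p).
by rewrite diamond_cut0 diamond_cut_last => ? ?; apply/andP; split; lra.
Qed.

Lemma diamond_z_between j : (j < p)%N -> cut j.+1 < z j.+1 < cut j.
Proof.
move=> jp; have := r_over_gt0 jp; have := diamond_cutS j.
by have := diamond_z_cut j => ? ? ?; apply/andP; split; lra.
Qed.

Lemma diamond_z_itv j : (1 <= j <= p)%N -> -1 < z j < 1.
Proof.
case: j => // j /andP[_ jp]; have /andP[? ?] := diamond_z_between jp.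
have /andP[? ?] := diamond_cut_itv jp; have /andP[? ?] := diamond_cut_itv (ltnW jp).
by apply/andP; split; lra.
Qed.

Lemma diamond_z_decr j k : (1 <= j)%N -> (j < k)%N -> (k <= p)%N -> z k < z j.
Proof.
case: j k => [//|j] [//|k] _ jk kp.
have /andP[_ ?] := diamond_z_between kp.
have /andP[? _] : cut j.+1 < z j.+1 < cut j.
  by apply: diamond_z_between; lia.
have : cut k <= cut j.+1 by apply: diamond_cut_homo => //; lia.
by lra.
Qed.

Lemma diamond_z_inj j k : (1 <= j <= p)%N -> (1 <= k <= p)%N ->
  z j = z k -> j = k.
Proof.
move=> /andP[j1 jp] /andP[k1 kp] zjk; case: (ltngtP j k) => // jk.
  by have := diamond_z_decr j1 jk kp; rewrite zjk ltxx.
by have := diamond_z_decr k1 jk jp; rewrite zjk ltxx.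
Qed.

(** The symmetry of [r] pairs the parallels below the equator with those above it, so [N - 1] equals
    the numerator in [z M]. *)
Lemma diamond_z_equator : z M = 0.
Proof.
have N2 := diamond_N_gt2; have N1 : N - 1 != 0 by apply/lt0r_neq0; lra.
have sumE : N - 1 = 1 + r M + 2 * \sum_(1 <= k < M) r k.
  rewrite diamond_NE// (@big_cat_nat _ _ _ M)//=; last lia.
  rewrite (@big_ltn _ _ _ M)//; last lia.
  have -> : \sum_(M.+1 <= k < 2 * M) r k = \sum_(1 <= k < M) r k.
    rewrite -{1}[M.+1]add1n big_addn big_nat_rev.
    have -> : (2 * M - M = M)%N by lia.
    apply: eq_big_nat => i iM; rewrite -[LHS]diamond_r_sym//; last lia.
    by congr (diamond_r P M _); lia.
  by ring.
by rewrite /diamond_z sumE mulfV ?subrr// -sumE.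
Qed.

(** From [cos (a - b) = 1] the sine of half the difference vanishes, and that half lies in
    [[0, pi)]. *)
Lemma cos_sin_inj (a b : R) : 0 <= a - b < 2 * pi ->
  cos a = cos b -> sin a = sin b -> a = b.
Proof.
move=> /andP[ab0 ab2] cE sE; pose d := (a - b) / 2.
have : cos (d + d) = 1.
  have -> : d + d = a - b by rewrite /d; lra.
  by rewrite cosB cE sE -!expr2 cos2Dsin2.
rewrite cosD -!expr2 cos2sin2 => sd2.
have sd : sin d = 0 by apply/eqP; rewrite -sqrf_eq0; apply/eqP; lra.
have [d0|d0] := leP d 0; first by rewrite /d in d0; lra.
have : 0 < sin d by apply: sin_gt0_pi; rewrite d0 /d; lra.
by rewrite sd ltxx.
Qed.

Variable theta : nat -> R.
Local Notation x := (diamond_point P M theta).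

Lemma diamond_point_spherical j i : (1 <= j <= p)%N ->
  x j i = spherical_coordinates (acos (z j)) (2 * pi * i%:R / r j + theta j).
Proof.
move=> jp; have /andP[z1 z2] := diamond_z_itv jp.
by rewrite /spherical_coordinates sin_acos ?acosK ?in_itv/= ?ltW.
Qed.

Lemma point3_inj (a b c a' b' c' : R) :
  point3 a b c = point3 a' b' c' -> [/\ a = a', b = b' & c = c'].
Proof.
move=> e; have E i := congr1 (fun q : 'rV[R]_3 => q 0 i) e.
by move: (E 0) (E 1) (E 2%:R); rewrite !mxE.
Qed.

(** The height determines the parallel; on one parallel the radius is nonzero and two angles differ
    by less than a full turn. *)
Lemma diamond_point_inj j i j' i' :
  (1 <= j <= p)%N -> (1 <= j' <= p)%N ->
  (1 <= i <= rn j)%N -> (1 <= i' <= rn j')%N ->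
  x j i = x j' i' -> j = j' /\ i = i'.
Proof.
move=> jp jp' + + e; have [e1 e2 /(diamond_z_inj jp jp') jj] := point3_inj e.
subst j'; move=> ir ir'; split=> //.
have /andP[z1 z2] := diamond_z_itv jp.
have rho0 : Num.sqrt (1 - z j ^+ 2) != 0.
  by rewrite gt_eqF// sqrtr_gt0; nra.
have r0 : 0 < r j := diamond_r_gt0 PM jp.
have angle k k' : (1 <= k <= rn j)%N -> (1 <= k' <= rn j)%N -> (k' <= k)%N ->
    x j k = x j k' -> k = k'.
  move=> kr kr' kk /point3_inj[/(mulfI rho0) c1 /(mulfI rho0) s1 _].
  have := cos_sin_inj _ c1 s1.
  rewrite opprD addrACA subrr addr0 -mulrBl -mulrBr -natrB//.
  have -> : 0 <= 2 * pi * (k - k')%:R / r j < 2 * pi.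
    rewrite divr_ge0 ?mulr_ge0 ?pi_ge0 ?(ltW r0)//= ltr_pdivrMr//.
    by rewrite ltr_pM2l ?mulr_gt0 ?pi_gt0// diamond_rnE// ltr_nat; lia.
  move=> /(_ isT) /addIr /(mulIf (invr_neq0 (lt0r_neq0 r0))).
  move=> /mulfI => /(_ (lt0r_neq0 (mulr_gt0 (ltr0Sn _ 1) (pi_gt0 R)))).
  by move=> /eqP; rewrite eqr_nat => /eqP.
have [|/ltnW] := leqP i' i => ii; first exact: angle e.
by apply/esym/angle => //; exact/esym.
Qed.

(** A duplicate-free listing, which turns cardinals into sums over the parallels and their
    points. *)
Definition diamond_seq : seq 'rV[R]_3 :=
  [:: point3 0 0 1, point3 0 0 (-1) &
    [seq x j i | j <- index_iota 1 p.+1, i <- index_iota 1 (rn j).+1]].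

Lemma diamond_seq_uniq : uniq diamond_seq.
Proof.
have notin a : a = 1 \/ a = -1 -> point3 0 0 a \notin
    [seq x j i | j <- index_iota 1 p.+1, i <- index_iota 1 (rn j).+1].
  move=> a1; apply/negP => /allpairsPdep[j [i [jp _ /point3_inj[_ _ az]]]].
  rewrite mem_index_iota ltnS in jp; have /andP[] := diamond_z_itv jp.
  by case: a1 az => -> <-; rewrite ltxx.
rewrite /= inE negb_or !notin; [|by right|by left]; rewrite !andbT; apply/andP; split.
  by apply/eqP => /point3_inj[_ _]; lra.
apply: allpairs_uniq_dep; first exact: iota_uniq.
  by move=> j _; exact: iota_uniq.
move=> _ _ /allpairsPdep[j [i [+ + ->]]] /allpairsPdep[j' [i' [+ + ->]]] /=.
rewrite !mem_index_iota !ltnS => jp ir jp' ir' e.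
by have [-> ->] := diamond_point_inj jp jp' ir ir' e.
Qed.

Lemma diamond_seqE : diamond P M theta = [set` diamond_seq].
Proof.
apply/seteqP; split=> q /=; rewrite !inE.
  case=> [[->|->]|[j [i [jp i1 ir ->]]]]; rewrite ?eqxx ?orbT//.
  apply/orP; right; apply/orP; right; apply/allpairsPdep; exists j, i.
  rewrite !mem_index_iota !ltnS jp i1; split=> //.
  by move: ir; rewrite diamond_rnE// ler_nat.
case/or3P => [/eqP ->|/eqP ->|]; [by left; left|by left; right|].
move=> /allpairsPdep[j [i [+ + ->]]]; rewrite !mem_index_iota !ltnS => jp ir.
right; exists j, i; split=> //; first by case/andP: ir.
by rewrite diamond_rnE// ler_nat; case/andP: ir.
Qed.

Lemma card_set_seq (s : seq 'rV[R]_3) (C : set 'rV[R]_3) : uniq s ->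
  card_set ([set` s] `&` C) = \sum_(q <- s) \1_C q.
Proof.
move=> us; rewrite /card_set.
have -> : [set` s] `&` C = [set` [fset q in [seq q <- s | q \in C]]%fset].
  apply/seteqP; split=> q /=; rewrite !inE mem_filter /=.
    by move=> [-> /mem_set ->].
  by move=> /andP[/set_mem ? ?].
rewrite set_fsetK card_fseq undup_id ?filter_uniq// size_filter.
rewrite -sum1_count natr_sum big_mkcond; apply: eq_bigr => q _.
by rewrite indicE; case: ifP.
Qed.

Lemma card_diamond_cap (C : set 'rV[R]_3) :
  card_set (diamond P M theta `&` C) =
  \1_C (point3 0 0 1) + \1_C (point3 0 0 (-1)) +
  \sum_(1 <= j < p.+1) \sum_(1 <= i < (rn j).+1) \1_C (x j i).
Proof.
rewrite diamond_seqE card_set_seq ?diamond_seq_uniq//.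
by rewrite !big_cons addrA big_allpairs_dep.
Qed.

Lemma card_diamond : card_set (diamond P M theta) = N.
Proof.
rewrite -[X in card_set X]setIT card_diamond_cap !indicE !in_setT /diamond_N.
congr (_ + _); apply: eq_big_nat => j jp; rewrite diamond_rnE//.
under eq_bigr do rewrite indicE in_setT.
by rewrite sumr_const_nat subn1.
Qed.

End DiamondPoints.

(** * Quadrature of the area of a cap over the parallels *)

Section CapIntegral.
Variables (R : realType) (P : diamond_parameters R) (M : nat).
Hypothesis PM : dM P M.
Notation mu := (@lebesgue_measure R).

Local Notation r := (diamond_r P M).
Local Notation rn := (diamond_rn P M).
Local Notation N := (diamond_N P M).
Local Notation p := (diamond_p M).
Local Notation z := (diamond_z P M).
Local Notation cut := (diamond_cut P M).
Local Notation A := (dA P).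
Implicit Types (u v t : R).

Lemma acos_le (x y : R) : -1 <= x -> x <= y -> y <= 1 -> acos y <= acos x.
Proof.
move=> x1 xy y1.
have x11 : -1 <= x <= 1 by rewrite x1 (le_trans xy).
have y11 : -1 <= y <= 1 by rewrite y1 (le_trans x1).
rewrite leNgt -ltr_cos ?in_itv/= ?acos_ge0 ?acos_lepi//.
by rewrite !acosK ?in_itv//= -leNgt.
Qed.

Lemma integral_zone_telescope u0 u1 v t (b : nat -> R) m :
  (forall j, (j < m)%N -> b j <= b j.+1) ->
  \sum_(0 <= j < m) \int[mu]_(x in `]b j, b j.+1]) (zone_fraction u0 u1 v t x * sin x)
  = \int[mu]_(x in `]b 0%N, b m]) (zone_fraction u0 u1 v t x * sin x).
Proof.
have ms : measurable_fun setT (@sin R).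
  by apply: continuous_measurable_fun; exact: continuous_sin.
move=> bS; apply: integral_itv_telescope => //.
  by apply: measurable_funM => //; exact: measurable_zone_fraction.
move=> x; rewrite normrM -[1]mulr1; apply: ler_pM => //; last exact: sin_max.
by have /andP[? ?] := zone_fraction01 u0 u1 v t x; rewrite ger0_norm.
Qed.

(** As in Archimedes' theorem, the area between two parallels is proportional to the difference of
    their heights. *)
Lemma integral_zone_between u0 u1 v t a b m1 m2 : 0 <= a -> a <= b -> b <= pi ->
  (forall x, a < x <= b -> m1 <= zone_fraction u0 u1 v t x <= m2) ->
  m1 * (cos a - cos b) <=
    \int[mu]_(x in `]a, b]) (zone_fraction u0 u1 v t x * sin x) <=
  m2 * (cos a - cos b).
Proof.
move=> a0 ab bpi zm; apply: integral_weighted_between => //.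
- exact: measurable_zone_fraction.
- by apply: continuous_measurable_fun; exact: continuous_sin.
- by move=> x; exact: zone_fraction01.
- by move=> x; exact: sin_max.
- by move=> x /andP[ax xb]; apply: sin_ge0_pi; apply/andP; split; lra.
- exact: integral_sin.
Qed.

(** Each polar cap adds at most [1 / (N - 1)], whence the 2. Between them the cells have height at
    most [4 A M / (N - 1)] and the fraction has variation at most 2, whence the [8 A M]. *)
Lemma cap_integral_error u0 u1 v t :
  `|\int[mu]_(x in `]0, pi]) (zone_fraction u0 u1 v t x * sin x) -
    \sum_(1 <= j < p.+1) zone_fraction u0 u1 v t (acos (z j)) *
      (2 * r j / (N - 1))| <= (2 + 8 * A * M%:R) / (N - 1).
Proof.
set f := zone_fraction u0 u1 v t.
have N2 := diamond_N_gt2 PM; have N1 : 0 < N - 1 by lra.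
have cI j : (j <= p)%N -> -1 <= cut j <= 1.
  by move=> /(diamond_cut_itv PM)/andP[? ?]; rewrite !ltW.
pose b j := acos (cut j); pose c j := acos (z j.+1).
have cosb j : (j <= p)%N -> cos (b j) = cut j.
  by move=> /cI jp; rewrite acosK ?in_itv.
(* The outer cuts stay off the poles, so [sin], by which [level] divides, is positive on the middle
   range. *)
have b00 : 0 < b 0%N.
  by apply: acos_gt0; have /andP[/ltW -> ->] := diamond_cut_itv PM (leq0n p).
have bppi : b p < pi.
  by apply: acos_ltpi; have /andP[-> /ltW ->] := diamond_cut_itv PM (leqnn p).
have b0p : b 0%N <= b p.
  have /andP[c1 _] := cI p (leqnn p); have /andP[_ c2] := cI 0%N (leq0n p).
  by apply: acos_le => //; exact: (diamond_cut_homo PM (leq0n p)).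
have f01 x : 0 <= f x <= 1 := zone_fraction01 u0 u1 v t x.
have split3 : \int[mu]_(x in `]0, pi]) (f x * sin x) =
    \int[mu]_(x in `]0, b 0%N]) (f x * sin x) +
    \int[mu]_(x in `]b 0%N, b p]) (f x * sin x) +
    \int[mu]_(x in `]b p, pi]) (f x * sin x).
  pose d := nth 0 [:: 0; b 0%N; b p; pi].
  rewrite -(integral_zone_telescope u0 u1 v t (b := d) (m := 3)); last first.
    by case=> [|[|[|//]]] _; rewrite /d /=; [exact: ltW| |exact: ltW].
  by rewrite !big_nat_recr //= big_nil add0r.
have north : 0 <= \int[mu]_(x in `]0, b 0%N]) (f x * sin x) <= (N - 1)^-1.
  have := @integral_zone_between u0 u1 v t 0 (b 0%N) 0 1.
  rewrite mul0r mul1r cos0 cosb// (diamond_cut0 P M) opprB addrCA subrr addr0.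
  by apply => //; rewrite ltW// (le_lt_trans b0p).
have south : 0 <= \int[mu]_(x in `]b p, pi]) (f x * sin x) <= (N - 1)^-1.
  have := @integral_zone_between u0 u1 v t (b p) pi 0 1.
  rewrite mul0r mul1r cospi cosb// (diamond_cut_last PM) opprK addrAC addNr add0r.
  by apply => //; rewrite ltW// (lt_le_trans b00).
have -> : \sum_(1 <= j < p.+1) f (acos (z j)) * (2 * r j / (N - 1)) =
    \sum_(0 <= j < p) f (c j) * (- cos (b j.+1) - - cos (b j)).
  rewrite big_add1 /=; apply: eq_big_nat => j /andP[_ jp].
  rewrite /c; congr (_ * _).
  by rewrite !cosb ?(ltnW jp)// diamond_cutS diamond_z_cut; ring.
have middle : `|\int[mu]_(x in `]b 0%N, b p]) (f x * sin x) -
    \sum_(0 <= j < p) f (c j) * (- cos (b j.+1) - - cos (b j))| <=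
    4 * A * M%:R / (N - 1) * 2.
  have A0 := dA_ge2 P.
  apply: (@quadrature_integral R f sin (fun x => - cos x)) => //.
  - exact: measurable_zone_fraction.
  - by apply: continuous_measurable_fun; exact: continuous_sin.
  - by move=> x; exact: sin_max.
  - by move=> x /andP[? ?]; apply: sin_ge0_pi; apply/andP; split; lra.
  - by move=> x y _ xy _; rewrite integral_sin// opprK addrC.
  - move=> j jp; have /andP[? ?] := diamond_z_between PM jp.
    have /andP[? ?] := cI j.+1 jp; have /andP[? ?] := cI j (ltnW jp).
    have /andP[/ltW ? /ltW ?] : -1 < z j.+1 < 1 by apply: diamond_z_itv.
    by apply/andP; split; apply: acos_le => //; exact: ltW.
  - move=> j jp; rewrite !cosb ?(ltnW jp)// diamond_cutS diamond_z_cut.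
    have : r j.+1 <= 2 * A * M%:R by apply: diamond_r_le.
    rewrite -(ler_pM2r (_ : 0 < (N - 1)^-1)) ?invr_gt0//; lra.
  - by rewrite divr_ge0 ?mulr_ge0 ?(ltW N1)//; lra.
  (* Off the poles the fraction is an antitone function of the level, which has at most two monotone
     pieces. *)
  - apply: variation_le_eq (_ : variation_le (arc_fraction u0 u1 \o level t v) _ _ _).
      move=> x /andP[bx xb] /=; rewrite /f zone_fractionE//.
      by apply: sin_gt0_pi; apply/andP; split; lra.
    apply: level_comp_variation => //; first by move=> y; exact: arc_fraction01.
    by move=> x y; exact: arc_fraction_le.
have -> : (2 + 8 * A * M%:R) / (N - 1) =
    (N - 1)^-1 + 4 * A * M%:R / (N - 1) * 2 + (N - 1)^-1 by ring.
rewrite split3; move: north south middle.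
set I0 := \int[mu]_(x in _) _; set I1 := \int[mu]_(x in _) _.
set I2 := \int[mu]_(x in _) _; set S := \sum_(_ <= _ < _) _.
move=> /andP[? ?] /andP[? ?] /ler_normlP[? ?].
by rewrite ler_norml; apply/andP; split; lra.
Qed.

End CapIntegral.

(** * Deviation of the counts, from above and from below *)

Section DiamondDiscrepancy.
Variables (R : realType) (P : diamond_parameters R) (M : nat).
Hypothesis PM : dM P M.
Variable theta : nat -> R.
Notation mu := (@lebesgue_measure R).

Local Notation r := (diamond_r P M).
Local Notation rn := (diamond_rn P M).
Local Notation N := (diamond_N P M).
Local Notation p := (diamond_p M).
Local Notation z := (diamond_z P M).
Local Notation A := (dA P).
Implicit Types (u : 'rV[R]_3) (t : R).

Local Notation zone_of u t := (zone_fraction (u 0 0) (u 0 1) (u 0 2%:R) t).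

Lemma parallel_count_error u t j : 0 <= theta j -> (1 <= j <= p)%N ->
  `|\sum_(1 <= i < (rn j).+1) \1_(spherical_cap u t) (diamond_point P M theta j i)
    - r j * zone_of u t (acos (z j))| <= 4.
Proof.
move=> th0 jp; have /andP[z1 z2] := diamond_z_itv PM jp.
have s0 : 0 < sin (acos (z j)).
  by apply: sin_gt0_pi; rewrite acos_gt0 ?acos_ltpi// ?z1 ?z2 ?ltW.
rewrite zone_fractionE// diamond_rnE//.
have := @arc_count R (u 0 0) (u 0 1) (level t (u 0 2%:R) (acos (z j)))
  (theta j) (rn j) (diamond_rn_gt0 PM jp) th0.
congr (`|_ - _| <= _); apply: eq_bigr => i _.
rewrite diamond_point_spherical// diamond_rnE//.
set a := _ / _ + _; have := cap_spherical_coordinates u t (acos (z j), a).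
move=> /= ->; rewrite /zone_indicator /arc_indicator /level /=.
by rewrite ler_pdivrMr// lerBlDr mulrC.
Qed.

(** The poles account for 2, and each of the fewer than [2 M] parallels for 4. *)
Lemma cap_count_error u t : (forall j, (1 <= j <= p)%N -> 0 <= theta j) ->
  `|card_set (diamond P M theta `&` spherical_cap u t) -
    \sum_(1 <= j < p.+1) r j * zone_of u t (acos (z j))| <= 2 + 8 * M%:R.
Proof.
move=> th0; rewrite card_diamond_cap//.
set C := spherical_cap u t.
have ind q : 0 <= (\1_C q : R) <= 1 by rewrite indicE ler0n lern1 leq_b1.
have /andP[n0 n1] := ind (point3 0 0 1).
have /andP[s0 s1] := ind (point3 0 0 (-1)).
have : `|\sum_(1 <= j < p.+1)
    (\sum_(1 <= i < (rn j).+1) \1_C (diamond_point P M theta j i)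
     - r j * zone_of u t (acos (z j)))| <= 8 * M%:R.
  apply: le_trans (ler_norm_sum _ _ _) _.
  apply: (@le_trans _ _ (\sum_(1 <= j < p.+1) 4)).
    rewrite big_nat_cond [leRHS]big_nat_cond; apply: ler_sum => j.
    by rewrite andbT ltnS => jp; apply: parallel_count_error => //; exact: th0.
  rewrite sumr_const_nat subn1 /= -[leLHS]mulr_natl.
  have : p%:R <= 2 * M%:R :> R by rewrite -natrM ler_nat /diamond_p; lia.
  by lra.
rewrite sumrB; set X := \sum_(_ <= _ < _) _; set Y := \sum_(_ <= _ < _) _.
by move=> /ler_normlP[? ?]; rewrite ler_norml; apply/andP; split; lra.
Qed.

(** In units of [1 / N], the errors are [2 + 8 M] from the count, 1 from exchanging [N - 1] and [N],
    and [2 + 8 A M] from the quadrature; as [M >= 1], they sum to at most [(13 + 8 A) M]. *)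
Lemma cap_deviation_le u t : (forall j, (1 <= j <= p)%N -> 0 <= theta j) ->
  `|card_set (diamond P M theta `&` spherical_cap u t) /
      card_set (diamond P M theta) -
    fine (surface_measure (spherical_cap u t)) / (4 * pi)| <=
  (13 + 8 * A) * M%:R / N.
Proof.
move=> th0; have N2 := diamond_N_gt2 PM.
rewrite card_diamond// surface_measure_cap.
have := cap_count_error u t th0.
have := cap_integral_error PM (u 0 0) (u 0 1) (u 0 2%:R) t.
set f := zone_fraction _ _ _ t; set I := \int[mu]_(x in _) _.
set K := card_set _; set T := \sum_(1 <= j < p.+1) r j * f (acos (z j)).
have -> : \sum_(1 <= j < p.+1) f (acos (z j)) * (2 * r j / (N - 1)) =
    2 * T / (N - 1).
  rewrite mulr_sumr mulr_suml; apply: eq_bigr => j _; ring.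
have [T0 TN] : 0 <= T /\ T <= N - 2.
  have rf j : (1 <= j < p.+1)%N -> 0 <= r j * f (acos (z j)) <= r j.
    rewrite ltnS => jp; have r0 := ltW (diamond_r_gt0 PM jp).
    have /andP[f0 f1] := zone_fraction01 (u 0 0) (u 0 1) (u 0 2%:R) t (acos (z j)).
    by rewrite mulr_ge0//= ler_piMr.
  split; first by rewrite /T big_nat; apply: sumr_ge0 => j /rf /andP[].
  rewrite /diamond_N addrAC subrr add0r /T big_nat [leRHS]big_nat.
  by apply: ler_sum => j /rf /andP[].
have M1 : 1 <= M%:R :> R by rewrite ler1n; exact: dM_gt0 PM.
have A2 := dA_ge2 P.
have [h0 k0] : 0 < N^-1 /\ 0 < (N - 1)^-1 by rewrite !invr_gt0; split; lra.
have hN : N * N^-1 = 1 by rewrite mulfV//; apply: lt0r_neq0; lra.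
have kN : (N - 1) * (N - 1)^-1 = 1 by rewrite mulfV//; apply: lt0r_neq0; lra.
move: h0 k0 hN kN N2 TN; move: N ((N - 1)^-1) (N^-1) => n k h.
move=> h0 k0 hn kn n2 Tn /ler_normlP[I1 I2] /ler_normlP[K1 K2].
have kh : k - h = h * k.
  transitivity (h * k * (n - (n - 1))); last by ring.
  by rewrite mulrBr mulrAC [h * n]mulrC hn mul1r -mulrA [k * _]mulrC kn mulr1.
have k2h : k <= 2 * h.
  suff : h * k <= h by move: kh; lra.
  rewrite ler_piMr//; first exact: ltW.
  by rewrite -kn ler_peMl ?(ltW k0)//; lra.
have Tk : T * k <= 1.
  by rewrite -kn ler_wpM2r ?(ltW k0)//; lra.
have Tkh : 0 <= T * (k - h) <= h.
  rewrite kh mulrCA mulr_ge0 ?mulr_ge0 ?(ltW h0) ?(ltW k0)//=.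
  by rewrite ler_piMr ?(ltW h0).
have e1 : (K - T) * h <= (2 + 8 * M%:R) * h by rewrite ler_wpM2r ?(ltW h0).
have e2 : - (K - T) * h <= (2 + 8 * M%:R) * h by rewrite ler_wpM2r ?(ltW h0).
have AM : 0 <= A * M%:R by rewrite mulr_ge0//; lra.
(* The factor 2 lost here is regained from the one half in the area formula. *)
have e3 : (2 + 8 * A * M%:R) * k <= (2 + 8 * A * M%:R) * (2 * h).
  by rewrite ler_wpM2l//; lra.
have e4 : h <= M%:R * h by rewrite ler_peMl ?(ltW h0).
move: Tkh => /andP[? ?].
by rewrite ler_norml; apply/andP; split; lra.
Qed.

Local Notation hemisphere := (spherical_cap (point3 0 0 1 : 'rV[R]_3) 0).

(** The north pole and the parallels down to the equator, included, number exactly half of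
    [N + r_M], while the hemisphere has half the area. *)
Lemma hemisphere_deviation :
  r M / (2 * N) <= `|card_set (diamond P M theta `&` hemisphere) /
      card_set (diamond P M theta) -
      fine (surface_measure hemisphere) / (4 * pi)|.
Proof.
set C := hemisphere; have N2 := diamond_N_gt2 PM; have pi0 := pi_gt0 R.
have M0 := dM_gt0 PM.
rewrite card_diamond// surface_measure_cap.
have [-> -> ->] : [/\ point3 0 0 1 0 0 = 0 :> R, point3 0 0 1 0 1 = 0 :> R &
  point3 0 0 1 0 2%:R = 1 :> R] by split; rewrite mxE.
set f := zone_fraction 0 0 1 0.
(* Every parallel lies wholly inside or wholly outside the hemisphere. *)
have fE x : f x = (0 <= cos x)%R%:R.
  rewrite /f /zone_fraction /zone_indicator /=.
  under eq_Rintegral do rewrite !mul0r addr0 mulr0 add0r mul1r.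
  rewrite Rintegral_cst//= lebesgue_measure_itv /= lte_fin mulr_gt0//=.
  rewrite subr0 mulrC mulfK//; apply: lt0r_neq0; exact: mulr_gt0.
have -> : \int[mu]_(x in `]0, pi]) (f x * sin x) = 1.
  pose d := nth 0 [:: 0; pi / 2; pi : R].
  rewrite -(integral_zone_telescope 0 0 1 0 (b := d) (m := 2)); last first.
    by case=> [|[|//]] _; rewrite /d /=; lra.
  rewrite !big_nat_recr //= big_nil add0r /d /= -/f.
  have /andP[a1 a2] : 1 * (cos 0 - cos (pi / 2)) <=
      \int[mu]_(x in `]0, pi / 2]) (f x * sin x) <= 1 * (cos 0 - cos (pi / 2)).
    apply: integral_zone_between; [by []|lra|lra|move=> x /andP[x0 x1]].
    rewrite -/f fE cos_ge0_pihalf ?lexx//; apply/andP; split; lra.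
  have /andP[b1 b2] : 0 * (cos (pi / 2) - cos pi) <=
      \int[mu]_(x in `]pi / 2, pi]) (f x * sin x) <= 0 * (cos (pi / 2) - cos pi).
    apply: integral_zone_between; [lra|lra|by []|move=> x /andP[x0 x1]].
    rewrite -/f fE; have -> : (0 <= cos x) = false; last by rewrite lexx.
    apply/negbTE; rewrite -ltNge -[ltRHS]cos_pihalf ltr_cos// in_itv /=;
      by apply/andP; split; lra.
  by move: a1 a2 b1 b2; rewrite cos0 cos_pihalf cospi; lra.
have card_ge : 1 + \sum_(1 <= j < M.+1) r j <=
    card_set (diamond P M theta `&` C).
  have inC q : 0 <= \1_C q :> R by rewrite indicE.
  have north : \1_C (point3 0 0 1) = 1 :> R.
    rewrite indicE mem_set// /C /spherical_cap /sphere2 /= dot_point3_self.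
    by rewrite expr0n /= !add0r expr1n.
  have upper j i : (1 <= j <= M)%N -> \1_C (diamond_point P M theta j i) = 1 :> R.
    move=> jM; have jp : (1 <= j <= p)%N by rewrite /diamond_p; lia.
    rewrite diamond_point_spherical//.
    set a := _ / _ + _.
    have := cap_spherical_coordinates (point3 0 0 1) 0 (acos (z j), a).
    move=> /= ->; rewrite /zone_indicator /= !mxE /= !mul0r addr0 mulr0 add0r mul1r.
    have /andP[z1 z2] := diamond_z_itv PM jp.
    rewrite acosK; last by rewrite in_itv /= !ltW.
    suff -> : 0 <= z j by [].
    rewrite -(diamond_z_equator PM); have [->//|jM'] := eqVneq j M.
    by apply/ltW/diamond_z_decr => //; rewrite /diamond_p; lia.
  rewrite card_diamond_cap// north (@big_cat_nat _ _ _ M.+1 1 p.+1)//=; last first.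
    by rewrite /diamond_p; lia.
  have -> : \sum_(1 <= j < M.+1) r j = \sum_(1 <= j < M.+1)
      \sum_(1 <= i < (rn j).+1) \1_C (diamond_point P M theta j i).
    apply: eq_big_nat => j; rewrite ltnS => jM.
    rewrite diamond_rnE//; last by rewrite /diamond_p; lia.
    under eq_bigr do rewrite upper//.
    by rewrite sumr_const_nat subn1.
  rewrite -addrA lerD2l addrCA lerDl addr_ge0//.
  by apply: sumr_ge0 => j _; apply: sumr_ge0.
(* This is [z M = 0] cleared of its denominator. *)
have half : 2 * (1 + \sum_(1 <= j < M.+1) r j) = N + r M.
  have := diamond_z_equator PM; rewrite /diamond_z => /eqP; rewrite subr_eq0.
  have N1 : N - 1 != 0 by apply: lt0r_neq0; lra.
  rewrite eq_sym -(inj_eq (mulIf N1)) divfK// mul1r => /eqP.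
  by rewrite big_nat_recr//=; lra.
apply: le_trans (ler_norm _).
have h0 : 0 < N^-1 by rewrite invr_gt0; lra.
have hN : N * N^-1 = 1 by rewrite mulfV//; apply: lt0r_neq0; lra.
rewrite mulr1 invfM; move: card_ge.
rewrite -(ler_pM2r h0); set K := card_set _; move: half h0 hN.
set S := \sum_(_ <= _ < _) _; move: (N^-1) => h half h0 hN KS.
have : 2 * (1 + S) * h = (N + r M) * h by rewrite half.
by lra.
Qed.

End DiamondDiscrepancy.

(** * From orders in [M] to orders in the square root of [N] *)

Theorem theorem1p2 (R : realType) (P : diamond_parameters R) :
  exists c1 c2 : R, [/\ 0 < c1, 0 < c2 &
    forall (M : nat) (theta : nat -> R),
      dM P M ->
      (forall j : nat, (1 <= j <= diamond_p M)%N -> 0 <= theta j <= 2 * pi) ->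
      c1 / Num.sqrt (diamond_N P M) <= cap_discrepancy (diamond P M theta)
        <= c2 / Num.sqrt (diamond_N P M)].
Proof.
have A2 := dA_ge2 P; have c0 := dc_gt0 P.
have A0 : 0 < dA P by lra.
(* With [s] the square root of [N]: [(13 + 8 A) M / N] and [M <= 2 s / c] give the upper constant,
   [c M / (2 N)] and [M >= s / (2 A)] the lower one. *)
exists (dc P / (4 * dA P)), (2 * (13 + 8 * dA P) / dc P); split.
- by rewrite divr_gt0// mulr_gt0.
- by rewrite divr_gt0// mulr_gt0//; lra.
move=> M theta PM th.
have th0 j : (1 <= j <= diamond_p M)%N -> 0 <= theta j by move=> /th/andP[].
have N2 := diamond_N_gt2 PM; set s := Num.sqrt _.
have s0 : 0 < s by rewrite sqrtr_gt0; lra.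
have sN : s ^+ 2 = diamond_N P M by rewrite sqr_sqrtr//; lra.
have M0 : 0 <= M%:R :> R by [].
(* The square root of 2 is rounded up to 2. *)
have cM : dc P * M%:R <= 2 * s.
  rewrite -ler_sqr ?nnegrE ?mulr_ge0 ?(ltW c0) ?(ltW s0)// [leRHS]exprMn sN.
  by have := diamond_N_ge PM; lra.
have sA : s <= 2 * dA P * M%:R.
  rewrite -ler_sqr ?nnegrE ?mulr_ge0 ?(ltW A0) ?(ltW s0)// sN.
  exact: diamond_N_le.
have upper u t : `|card_set (diamond P M theta `&` spherical_cap u t) /
      card_set (diamond P M theta) -
    fine (surface_measure (spherical_cap u t)) / (4 * pi)| <=
    2 * (13 + 8 * dA P) / dc P / s.
  apply: le_trans (cap_deviation_le PM u t th0) _.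
  rewrite -sN ler_pdivrMr ?exprn_gt0// expr2 mulrA divfK ?lt0r_neq0//.
  rewrite [leRHS]mulrAC ler_pdivlMr//.
  have : (13 + 8 * dA P) * (dc P * M%:R) <= (13 + 8 * dA P) * (2 * s).
    by rewrite ler_wpM2l//; lra.
  by lra.
pose C : set 'rV[R]_3 := spherical_cap (point3 0 0 1) 0.
have capC : caps C.
  exists (point3 0 0 1), 0; split=> //; last by rewrite lerN10 ler01.
  by rewrite /sphere2 /= dot_point3_self expr0n /= !add0r expr1n.
rewrite /cap_discrepancy; set D := [set _ | C in _].
have DC : D `|card_set (diamond P M theta `&` C) / card_set (diamond P M theta)
  - fine (surface_measure C) / (4 * pi)| by exists C.
have Dub : ubound D (2 * (13 + 8 * dA P) / dc P / s).
  by move=> _ [_ [u [t [_ _ ->]]] <-]; exact: upper.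
(* The hemisphere makes [D] nonempty, which the upper bound on the supremum needs; [Dub] makes it
   bounded, so that the supremum dominates the value at the hemisphere. *)
apply/andP; split; last by apply: ge_sup => //; eexists; exact: DC.
apply: le_trans (ub_le_sup (ex_intro _ _ Dub) DC).
apply: le_trans (hemisphere_deviation PM theta).
have rM := diamond_r_equator PM.
rewrite -sN ler_pdivlMr ?mulr_gt0 ?exprn_gt0//.
have cancel (a b q : R) : b != 0 -> q != 0 ->
    a / b / q * (2 * q ^+ 2) = 2 * a * q / b by move=> b0 q0; field; rewrite b0.
rewrite cancel ?mulf_neq0 ?lt0r_neq0// ler_pdivrMr ?mulr_gt0//.
have : dc P * s <= dc P * (2 * dA P * M%:R) by rewrite ler_wpM2l// ltW.
have : (dc P * M%:R) * (4 * dA P) <= diamond_r P M M * (4 * dA P).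
  by rewrite ler_wpM2r// mulr_ge0// ltW.
by lra.
Qed.
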